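(* Let $X\subseteq\mathbb{R}^n$ and $\Theta\subseteq\mathbb{R}^p$ be nonempty closed convex sets, let $f$ (on $X\times\Theta$, differentiable in $x$) and $h$ (on $\Theta$, differentiable) satisfy the gradient specifications listed in the context, let the step sizes $\{\gamma_k\},\{\beta_k\}$ satisfy the step-size conditions listed in the context, let $\theta^*=\operatorname{argmin}_{\theta\in\Theta}h(\theta)$, and assume that $\min_{x\in X}f(x,\theta^* )$ is attained. Let $\{x_k\},\{\theta_k\}$ be the random sequences generated from $x_0\in X$, $\theta_0\in\Theta$ by the joint scheme described in the context, where the noise $\{w_k\}$ satisfies the moment conditions listed in the context. Then, almost surely, $\{x_{k+1}\}$ converges to a point $x^*\in X$ that satisfies the first-order (KKT) stationarity conditions for the problem $\min_{x\in X}f(x,\theta^* )$, i.e. $\nabla f(x^*,\theta^* )^T(x-x^* )\ge0$ for all $x\in X$.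
   Context: $\|\cdot\|$ is the Euclidean norm, $\Pi_S$ is Euclidean projection onto a closed convex set $S$, and $\nabla f(x,\theta)$ denotes the gradient of $f$ with respect to $x$. Joint scheme (for $k\ge0$, with random noise vectors $w_k\in\mathbb{R}^p$): $$x_{k+1/2}=\Pi_X(x_k-\gamma_k\nabla f(x_k,\theta_k)),\quad x_{k+1}=\Pi_X(x_k-\gamma_k\nabla f(x_{k+1/2},\theta_k)),\quad \theta_{k+1}=\Pi_\Theta(\theta_k-\beta_k(\nabla h(\theta_k)+w_k)).$$ Noise: with $\mathcal{F}_k=\sigma(x_0,\theta_0,\dots,x_k,\theta_k)$, for all $k$, $\mathbb{E}[w_k\mid\mathcal{F}_k]=0$ and $\mathbb{E}[\|w_k\|^2\mid\mathcal{F}_k]\le\nu^2$ for a constant $\nu>0$. Step-size conditions: $\gamma_k,\beta_k>0$ deterministic; $\sum_k\gamma_k=\infty$, $\sum_k\gamma_k^2<\infty$; $\sum_k\beta_k=\infty$, $\sum_k\beta_k^2<\infty$; $\beta_k\le\beta_0\le 2\mu_h/L_h^2$ for all $k$; and for some $\tau\in(0,1)$, $\sum_k\gamma_k^{2-\tau}<\infty$ and $\lim_{k\to\infty}\gamma_k^\tau/\beta_k=0$. Gradient specifications: (a) for each $\theta\in\Theta$, $f(\cdot,\theta)$ is pseudoconvex on $X$, i.e. for $x_1,x_2\in X$, $\nabla f(x_1,\theta)^T(x_2-x_1)\ge0$ implies $f(x_2,\theta)\ge f(x_1,\theta)$. (b) $h$ is strongly convex with parameter $\mu_h>0$: $(\nabla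 h(\theta_1)-\nabla h(\theta_2))^T(\theta_1-\theta_2)\ge\mu_h\|\theta_1-\theta_2\|^2$ for all $\theta_1,\theta_2\in\Theta$. (c) For positive constants $L_f,L_\theta,L_h$ and all $x,x_1,x_2\in X$, $\theta,\theta_1,\theta_2\in\Theta$: $\|\nabla f(x_1,\theta)-\nabla f(x_2,\theta)\|\le L_f\|x_1-x_2\|$, $\|\nabla f(x,\theta_1)-\nabla f(x,\theta_2)\|\le L_\theta\|\theta_1-\theta_2\|$, $\|\nabla h(\theta_1)-\nabla h(\theta_2)\|\le L_h\|\theta_1-\theta_2\|$; moreover $\|\nabla f(x,\theta^* )\|\le B$ for all $x\in X$, for some $B>0$. The limit $x^*$ may depend on the sample path. *)

(* Defs.v *)
From HB Require Import structures.
From mathcomp Require Import all_boot all_order all_algebra.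
From mathcomp Require Import all_classical all_reals all_analysis.

Set Implicit Arguments.
Unset Strict Implicit.
Unset Printing Implicit Defensive.

Import Order.TTheory GRing.Theory Num.Theory.
Import numFieldNormedType.Exports.

Local Open Scope classical_set_scope.
Local Open Scope ring_scope.

Section Euclidean.
Context {R : realType} {n : nat}.
Implicit Types (u v : 'rV[R]_n) (S : set 'rV[R]_n) (g : 'rV[R]_n -> R).

Definition dotv u v : R := \sum_(i < n) u 0 i * v 0 i.

(* The library norm on matrices is the max norm.  It induces the same topology
   (limits, closed sets, differentiability) as this Euclidean norm. *)
Definition enorm u : R := Num.sqrt (dotv u u).

(* Euclidean projection.  The default value 0 is returned only when no nearest
   point exists, which cannot happen for S closed and nonempty; the nearest
   point is unique when S is moreover convex. *)
Definition projection S u : 'rV[R]_n :=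
  xget 0 [set y | S y /\ forall z, S z -> enorm (u - y) <= enorm (u - z)].

Definition gradient g u : 'rV[R]_n := \row_(i < n) 'D_(delta_mx 0 i) g u.

Definition is_minimizer S g u : Prop := S u /\ forall z, S z -> g u <= g z.

End Euclidean.

Section Conditioning.
Context {d : measure_display} {T : measurableType d} {R : realType}.

Definition random_vector n (u : T -> 'rV[R]_n) : Prop :=
  forall i, measurable_fun [set: T] (fun om => u om 0 i).

(* As i varies, these sets generate sigma(u): the Borel sigma-algebra of R^n is
   generated by the coordinate maps. *)
Definition coord_preimages n (u : T -> 'rV[R]_n) : set (set T) :=
  \bigcup_(i in [set: 'I_n])
    preimage_set_system [set: T] (fun om => u om 0 i) measurable.

Definition history n p (x : nat -> T -> 'rV[R]_n) (th : nat -> T -> 'rV[R]_p)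
    (k : nat) : set (set T) :=
  <<s \bigcup_(j in [set j | (j <= k)%N])
        (coord_preimages (x j) `|` coord_preimages (th j)) >>.

(* Y is a version of the conditional expectation E[Z | F]; versions agree
   P-almost surely. *)
Definition is_cond_exp (P : probability T R) (F : set (set T)) (Z Y : T -> R)
    : Prop :=
  [/\ P.-integrable [set: T] (EFin \o Z),
      P.-integrable [set: T] (EFin \o Y),
      forall B, measurable B -> F (Y @^-1` B) &
      forall A, F A ->
        (\int[P]_(om in A) (Y om)%:E = \int[P]_(om in A) (Z om)%:E)%E].

End Conditioning.

(* Main.v *)
Require Import Defs.
From HB Require Import structures.
From mathcomp Require Import all_boot all_order all_algebra.
From mathcomp Require Import all_classical all_reals all_analysis.
From mathcomp Require Import measurable_realfun ring lra.

Set Implicit Arguments.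
Unset Strict Implicit.
Unset Printing Implicit Defensive.

Import Order.TTheory GRing.Theory Num.Theory.
Import numFieldNormedType.Exports.

Local Open Scope classical_set_scope.
Local Open Scope ring_scope.

(** The proof separates the noise from the extragradient dynamics: randomness
    enters only through one almost sure summability statement about the errors
    e_k = |th_k - ths|, and everything else is an argument about a single
    sample path.

    Stochastic half.  The projection is nonexpansive and the noiseless step
    fixes ths, so
    strong monotonicity and Lipschitz continuity of grad h give
      e_(k+1)^2 + 2 mu b_k e_k^2
        <= (1 + L^2 b_k^2) e_k^2 - 2 b_k <v_k, w_k> + b_k^2 |w_k|^2,
    where v_k depends on th_k only ([projected_step_le], [drift_sqr_le]).
    Conditional centring kills the middle term in expectation
    ([cond_mean0_orthogonal]).  The expectations of e_k^2 then obey a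
    deterministic almost-decreasing recursion, so that the sum of
    b_k E[e_k^2] is finite ([robbins_siegmund]) and, exchanging sum and
    integral, the sum of b_k e_k^2 is finite almost surely
    ([weighted_err_summable]).  As th_0 need not be square integrable,
    expectations are restricted to the events |th_0 - ths| <= M, which exhaust
    the space.

    Pathwise half.  Since gam_k^tau / b_k tends to 0, the sum of
    gam_k^tau e_k^2 is finite on almost every path.  Once gam_k is small, an
    extragradient step with the perturbed gradient satisfies, for every
    minimizer s at ths,
      |x_(k+1) - s|^2 <= (1 + A_k) |x_k - s|^2 + B_k - |x_k - xh_k|^2 / 2
                         - 2 gam_k <grad f(xh_k, ths), xh_k - s>,
    where xh_k is the half step; the weighted Young inequality splits the
    cross term 2 gam_k e_k |x_k - s| into a part gam_k^(2-tau) |x_k - s|^2 and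
    a part gam_k^tau e_k^2, so A_k and B_k are summable
    ([extragradient_step_perturbed]).  The inner product is nonnegative because
    a pseudoconvex function has a pseudomonotone gradient
    ([pseudoconvex_minimizer_monotone]).  Hence |x_k - s| converges for every
    minimizer s, and as the gam_k are not summable some subsequence drives the
    inner product to 0 ([fejer], [frequently_near_critical]).  A cluster point
    y of it satisfies <grad f(y, ths), y - s> <= 0, so y is itself a minimizer
    by pseudoconvexity; taking s = y, the convergent sequence |x_k - y| has
    limit 0 ([extragradient_cvg]).  Minimizers over a convex set are stationary
    ([minimizer_first_order]). *)

(** * Euclidean geometry *)

Section Euclid.
Context {R : realType} {n : nat}.
Implicit Types (u v w y : 'rV[R]_n) (a : R).

Lemma dotvC u v : dotv u v = dotv v u.
Proof. by apply: eq_bigr => i _; rewrite mulrC. Qed.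

Lemma dotvDl u v w : dotv (u + v) w = dotv u w + dotv v w.
Proof. by rewrite -big_split; apply: eq_bigr => i _; rewrite mxE mulrDl. Qed.

Lemma dotvZl a u v : dotv (a *: u) v = a * dotv u v.
Proof. by rewrite mulr_sumr; apply: eq_bigr => i _; rewrite mxE mulrA. Qed.

Lemma dotvNl u v : dotv (- u) v = - dotv u v.
Proof. by rewrite -scaleN1r dotvZl mulN1r. Qed.

Lemma dotvDr u v w : dotv w (u + v) = dotv w u + dotv w v.
Proof. by rewrite dotvC dotvDl ![dotv w _]dotvC. Qed.

Lemma dotvZr a u v : dotv v (a *: u) = a * dotv v u.
Proof. by rewrite dotvC dotvZl dotvC. Qed.

Lemma dotvNr u v : dotv v (- u) = - dotv v u.
Proof. by rewrite dotvC dotvNl dotvC. Qed.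

Definition dotvE := (dotvDl, dotvDr, dotvNl, dotvNr, dotvZl, dotvZr).

Lemma dotvv_ge0 u : 0 <= dotv u u.
Proof. by apply: sumr_ge0 => i _; rewrite -expr2 sqr_ge0. Qed.

Lemma enorm_ge0 u : 0 <= enorm u.
Proof. exact: sqrtr_ge0. Qed.

Lemma sqr_enorm u : enorm u ^+ 2 = dotv u u.
Proof. by rewrite sqr_sqrtr // dotvv_ge0. Qed.

Lemma dot0v u : dotv 0 u = 0.
Proof. by rewrite -(scale0r 0) dotvZl mul0r. Qed.

Lemma enorm0 : enorm (0 : 'rV[R]_n) = 0.
Proof. by rewrite /enorm dot0v sqrtr0. Qed.

Lemma coord_le_enorm u i : `|u 0 i| <= enorm u.
Proof.
rewrite -sqrtr_sqr ler_wsqrtr // /dotv (bigD1 i) //= -expr2 lerDl.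
by apply: sumr_ge0 => j _; rewrite -expr2 sqr_ge0.
Qed.

Lemma norm_le_enorm u : `|u| <= enorm u.
Proof.
rewrite [`|u|]mx_normrE; apply/bigmax_leP; split; first exact: enorm_ge0.
by move=> [i j] _ /=; rewrite ord1 coord_le_enorm.
Qed.

Lemma enorm_eq0 u : enorm u = 0 -> u = 0.
Proof.
move=> u0; apply/rowP => i; rewrite mxE; apply/eqP.
by rewrite -normr_le0 -u0 coord_le_enorm.
Qed.

Lemma enormN u : enorm (- u) = enorm u.
Proof. by rewrite /enorm !dotvE opprK. Qed.

Lemma enorm_distC u v : enorm (u - v) = enorm (v - u).
Proof. by rewrite -enormN opprB. Qed.

Lemma ler_enorm_sqr u v : (enorm u <= enorm v) = (dotv u u <= dotv v v).
Proof. by rewrite -!sqr_enorm ler_sqr // nnegrE enorm_ge0. Qed.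

Lemma cauchy_schwarz u v : dotv u v <= enorm u * enorm v.
Proof.
have [uv_le0|uv_gt0] := leP (enorm u * enorm v) 0; last first.
  have := dotvv_ge0 (enorm v *: u - enorm u *: v).
  rewrite !dotvE -!sqr_enorm (dotvC v u) => ge0.
  suff : 0 <= enorm u * enorm v * (enorm u * enorm v - dotv u v).
    by rewrite pmulr_rge0 // subr_ge0.
  lra.
have /eqP : enorm u * enorm v = 0.
  by apply/eqP; rewrite eq_le uv_le0 mulr_ge0 ?enorm_ge0.
rewrite mulf_eq0 => /orP[] /eqP /enorm_eq0 ->.
  by rewrite dot0v mulr_ge0 ?enorm_ge0.
by rewrite dotvC dot0v mulr_ge0 ?enorm_ge0.
Qed.

Lemma ler_enormD u v : enorm (u + v) <= enorm u + enorm v.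
Proof.
rewrite -ler_sqr ?nnegrE ?addr_ge0 ?enorm_ge0 // sqr_enorm !dotvE (dotvC v u).
have := cauchy_schwarz u v; rewrite -!sqr_enorm; lra.
Qed.

Lemma enorm_continuous : continuous (@enorm R n).
Proof.
move=> u; apply: (@continuous_comp _ _ _ (fun u => dotv u u)); last first.
  exact: sqrt_continuous.
apply: (@cvg_big _ _ _ _ _ (@add_continuous _) _ _ _ _ _ (nbhs_filter u)) => i _.
exact: (@cvgM _ _ _ (nbhs_filter u) _ _ _ _
  (@coord_continuous _ _ _ 0 i u) (@coord_continuous _ _ _ 0 i u)).
Qed.

Lemma dist_enorm_continuous u : continuous (fun y => enorm (u - y)).
Proof.
move=> y; apply: (@continuous_comp _ _ _ (fun y => u - y)).
  by apply: (@cvgB _ _ _ (nbhs y)); [exact: cvg_cst|exact: cvg_id].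
exact: enorm_continuous.
Qed.

Lemma near_enorm_lt u (eps : R) : 0 < eps -> \forall v \near u, enorm (u - v) < eps.
Proof.
move=> eps0; have := @dist_enorm_continuous u u.
move=> /(@cvgr_lt _ _ _ (nbhs_filter u) _ _); apply.
by rewrite subrr enorm0.
Qed.

Lemma enorm_lipschitz_continuous (g : 'rV[R]_n -> R) (C : R) : 0 <= C ->
  (forall u v, `|g u - g v| <= C * enorm (u - v)) -> continuous g.
Proof.
move=> C0 gC u; apply/(@cvgrPdist_lt _ _ _ _ (nbhs_filter u)) => eps eps0.
have C1 : 0 < C + 1 by rewrite ltr_wpDl.
have := near_enorm_lt u (divr_gt0 eps0 C1).
apply: (@filterS _ _ (nbhs_filter u)) => v uv; apply: le_lt_trans (gC u v) _.
move: uv; rewrite ltr_pdivlMr // mulrC; apply: le_lt_trans.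
by rewrite ler_wpM2r ?enorm_ge0 // lerDl.
Qed.

End Euclid.

(** * Projection onto a closed convex set *)

Section Projection.
Context {R : realType} {n : nat}.
Implicit Types (u v y z : 'rV[R]_n) (S : set 'rV[R]_n).

Lemma compact_enorm_ball S u (r : R) : closed S ->
  compact (S `&` [set y | enorm (u - y) <= r]).
Proof.
move=> clS; apply: bounded_closed_compact; last first.
  apply: closedI => //.
  exact: (continuous_closedP _).1 (@dist_enorm_continuous _ _ u) _ (@closed_le _ r).
exists (`|u| + r); split; first exact: num_real.
move=> M ltM y [_ /= yr]; apply: le_trans (ltW ltM).
rewrite -(subKr u y) (le_trans (ler_normB _ _)) // lerD2l.
exact: le_trans (norm_le_enorm _) yr.
Qed.

(** A nearest point exists because only the compact part of S lying in a ball
    around u competes. *)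
Lemma projectionP S u : closed S -> S !=set0 ->
  S (projection S u) /\
  forall z, S z -> enorm (u - projection S u) <= enorm (u - z).
Proof.
move=> clS [z0 Sz0]; rewrite /projection; set Q := [set y | _].
apply: (@xgetPex _ 0 Q); pose r := enorm (u - z0).
have [|c] := EVT_min_rV _ (@compact_enorm_ball S u r clS)
  (continuous_subspaceT (@dist_enorm_continuous _ _ u)).
  by exists z0; split => //=.
rewrite inE => -[Sc cr] cmin; exists c; split=> // z Sz.
have [zr|/ltW rz] := leP (enorm (u - z)) r; last exact: le_trans cr rz.
by apply: cmin; rewrite inE.
Qed.

Lemma projection_in S u : closed S -> S !=set0 -> S (projection S u).
Proof. by move=> clS S0; case: (projectionP u clS S0). Qed.

Lemma convex_segment S y z (t : R) : convex_set S -> S y -> S z ->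
  0 <= t -> t <= 1 -> S (y + t *: (z - y)).
Proof.
move=> cvxS Sy Sz t0 t1.
have := cvxS z y (Itv01 t0 t1) (mem_set Sz) (mem_set Sy).
rewrite inE /conv /=; congr (S _).
by apply/rowP => i; rewrite !mxE /= /unstable.onem; ring.
Qed.

(** Moving from the nearest point p towards z by a fraction t changes the squared
    distance to u by - 2 t d + t ^+ 2 q, which would be negative for small t if
    d were positive. *)
Lemma projection_obtuse S u z : closed S -> convex_set S -> S z ->
  dotv (u - projection S u) (z - projection S u) <= 0.
Proof.
move=> clS cvxS Sz; have [Sp pmin] := projectionP u clS (ex_intro S z Sz).
move: (projection S u) Sp pmin => p Sp pmin.
set d := dotv _ _; pose q := dotv (z - p) (z - p).
have q0 : 0 <= q by exact: dotvv_ge0.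
have dq t : 0 <= t -> t <= 1 -> 2 * t * d <= t ^+ 2 * q.
  move=> t0 t1; have := pmin _ (convex_segment cvxS Sp Sz t0 t1).
  rewrite opprD addrA ler_enorm_sqr /d /q.
  move: (u - p) (z - p) => a b; rewrite !dotvE (dotvC b a); lra.
rewrite leNgt; apply/negP => d0.
have qd0 : 0 < q + d by lra.
have t0 : 0 < d / (q + d) by rewrite divr_gt0.
have t1 : d / (q + d) <= 1 by rewrite ler_pdivrMr //; lra.
(* the step length t = d / (q + d) lies in [0, 1] and satisfies t * q < 2 * d,
   whatever the size of q, zero included *)
have := dq _ (ltW t0) t1; rewrite expr2 -[leRHS]mulrA [2 * _]mulrC -mulrA.
rewrite ler_pM2l //.
have : d / (q + d) * (q + d) = d by rewrite mulfVK //; lra.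
have := mulr_gt0 t0 d0; lra.
Qed.

Lemma projection_unique S u y : closed S -> convex_set S -> S y ->
  (forall z, S z -> dotv (u - y) (z - y) <= 0) -> projection S u = y.
Proof.
move=> clS cvxS Sy yobt; apply/eqP; rewrite -subr_eq0; apply/eqP.
set p := projection S u; apply: enorm_eq0; apply/eqP.
have Sp : S p by apply: projection_in => //; exists y.
have := projection_obtuse u clS cvxS Sy; rewrite -/p.
have := yobt _ Sp.
rewrite -sqrf_eq0 eq_le sqr_ge0 andbT sqr_enorm !dotvE (dotvC y p) (dotvC u).
lra.
Qed.

Lemma projection_id S y : closed S -> convex_set S -> S y -> projection S y = y.
Proof.
move=> clS cvxS Sy; apply: projection_unique => // z _.
by rewrite subrr dot0v.
Qed.

Lemma projection_nonexpansive S u v : closed S -> convex_set S -> S !=set0 ->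
  enorm (projection S u - projection S v) <= enorm (u - v).
Proof.
move=> clS cvxS S0.
have Sp := projection_in u clS S0; have Sq := projection_in v clS S0.
have := projection_obtuse v clS cvxS Sp.
have := projection_obtuse u clS cvxS Sq.
move: (projection S u) (projection S v) => p q h1 h2.
have [->|pq0] := eqVneq (enorm (p - q)) 0; first exact: enorm_ge0.
have {}pq0 : 0 < enorm (p - q) by rewrite lt_neqAle eq_sym pq0 enorm_ge0.
rewrite -(ler_pM2r pq0) (le_trans _ (cauchy_schwarz _ _)) //.
rewrite -expr2 sqr_enorm.
move: h1 h2; rewrite !dotvE (dotvC q p).
lra.
Qed.

End Projection.

(** * First-order conditions *)

Section FirstOrder.
Context {R : realType} {n : nat}.
Implicit Types (a v y z : 'rV[R]_n) (S : set 'rV[R]_n) (g : 'rV[R]_n -> R).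

Lemma derive_gradient g a v : differentiable g a ->
  'D_v g a = dotv (gradient g a) v.
Proof.
move=> dg; rewrite deriveE // {1}[v]row_sum_delta linear_sum.
by apply: eq_bigr => i _; rewrite linearZ mxE deriveE // mulrC.
Qed.

Lemma is_derive_line g a v (t : R) : differentiable g (a + t *: v) ->
  is_derive t 1 (fun s : R => g (a + s *: v)) (dotv (gradient g (a + t *: v)) v).
Proof.
move=> dg; have quotE : (fun h : R => h^-1 *: (((fun s : R => g (a + s *: v))
      \o shift t) (h *: (1 : R)) - g (a + t *: v))) =
    (fun h : R => h^-1 *: ((g \o shift (a + t *: v)) (h *: v) - g (a + t *: v))).
  apply/funext => h /=; congr (_ *: (g _ - _)).
  by rewrite -[(h *: 1)]/(h * 1) mulr1 scalerDl addrCA.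
apply: DeriveDef.
  by rewrite /derivable quotE; exact: diff_derivable.
by rewrite -derive_gradient // /derive quotE.
Qed.

(** Both first-order conditions below refute a strict sign of a directional
    derivative by exhibiting a nearby point of the segment. *)
Lemma derive_gt0_increase (phi : R -> R) (t d : R) :
  is_derive t 1 phi d -> 0 < d ->
  exists2 s : R, 0 < s < 1 & phi t < phi (t + s).
Proof.
move=> [dphi phid] d0.
have /(cvgr_gt _) /(_ _ d0) : h^-1 *: ((phi \o shift t) (h *: (1 : R)) - phi t)
    @[h --> 0^'] --> d by rewrite -phid; exact: dphi.
rewrite near_withinE => /nbhs_ballP [e /= e0 He].
have m0 : 0 < Num.min e 1 by rewrite lt_min e0 ltr01.
have me : Num.min e 1 <= e by rewrite ge_min lexx.
have m1 : Num.min e 1 <= 1 by rewrite ge_min lexx orbT.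
exists (Num.min e 1 / 2); first by lra.
have h0 : 0 < Num.min e 1 / 2 by lra.
have := He (Num.min e 1 / 2); rewrite -ball_normE /= sub0r normrN gtr0_norm //.
rewrite -[_ *: 1]/(_ * 1) mulr1 => /(_ _ _)/wrap[]; first by lra.
  by rewrite gt_eqF.
by rewrite pmulr_rgt0 ?invr_gt0 // subr_gt0 addrC.
Qed.

Lemma minimizer_first_order g S a y : convex_set S ->
  differentiable g a -> is_minimizer S g a -> S y ->
  0 <= dotv (gradient g a) (y - a).
Proof.
move=> cvxS dg [Sa amin] Sy; rewrite leNgt; apply/negP => d0.
have dphi : is_derive (0 : R) 1 (fun s : R => g (a + s *: (y - a)))
    (dotv (gradient g a) (y - a)).
  have := @is_derive_line g a (y - a) 0; rewrite scale0r addr0; exact.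
have [|s /andP[s0 s1] /=] := derive_gt0_increase (is_deriveN dphi).
  by rewrite oppr_gt0.
rewrite !fctE scale0r addr0 add0r ltrN2 ltNge amin //.
by apply: convex_segment => //; exact: ltW.
Qed.

(** If the derivative of g along the segment from y to the minimizer xs were
    positive at y, pseudoconvexity would make y a minimizer as well; g would then
    have an interior maximum on the segment, strictly above its minimum, and at
    that critical point pseudoconvexity would bound it by g xs. *)
Lemma pseudoconvex_minimizer_monotone g S xs y : convex_set S ->
  (forall z, S z -> differentiable g z) ->
  (forall x1 x2, S x1 -> S x2 ->
    0 <= dotv (gradient g x1) (x2 - x1) -> g x1 <= g x2) ->
  is_minimizer S g xs -> S y -> 0 <= dotv (gradient g y) (y - xs).
Proof.
move=> cvxS dg pcvx [Sxs xsmin] Sy; rewrite leNgt; apply/negP => d0.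
pose phi (s : R) := g (y + s *: (xs - y)).
have Sseg (s : R) : 0 <= s -> s <= 1 -> S (y + s *: (xs - y)).
  by move=> s0 s1; exact: convex_segment.
have dphi (s : R) : 0 <= s -> s <= 1 ->
    is_derive s 1 phi (dotv (gradient g (y + s *: (xs - y))) (xs - y)).
  by move=> s0 s1; apply: is_derive_line; exact/dg/Sseg.
have phi0 : phi 0 = g y by rewrite /phi scale0r addr0.
have phi1 : phi 1 = g xs by rewrite /phi scale1r addrC subrK.
have up0 : 0 < dotv (gradient g y) (xs - y) by rewrite -opprB dotvNr oppr_gt0.
have gyxs : g y = g xs.
  by apply/eqP; rewrite eq_le xsmin // andbT pcvx // ltW.
have [s /andP[s0 s1]] : exists2 s : R, 0 < s < 1 & phi 0 < phi (0 + s).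
  apply: derive_gt0_increase up0; have := dphi 0.
  by rewrite scale0r addr0; apply; rewrite ?ler01.
rewrite add0r => phis.
have cphi : {within `[0, 1], continuous phi}.
  apply: derivable_within_continuous => t.
  by rewrite in_itv /= => /andP[t0 t1]; case: (dphi t t0 t1).
(* the maximum is above phi 0 = phi 1, hence interior *)
have [c] := EVT_max ler01 cphi; rewrite in_itv /= => /andP[c0 c1] cmax.
have phisc : phi s <= phi c by apply: cmax; rewrite in_itv /= !ltW.
have {}c0 : 0 < c.
  rewrite lt_neqAle c0 andbT; apply/eqP => c0'.
  by move: (lt_le_trans phis phisc); rewrite -c0' ltxx.
have {}c1 : c < 1.
  rewrite lt_neqAle c1 andbT; apply/eqP => c1'.
  by move: (lt_le_trans phis phisc); rewrite c1' phi0 phi1 gyxs ltxx.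
have crit : is_derive c 1 phi 0.
  apply: (@derive1_at_max _ _ 0 1); rewrite ?ler01 ?in_itv /= ?c0 ?c1 //.
    by move=> t; rewrite in_itv /= => /andP[t0 t1]; case: (dphi t (ltW t0) (ltW t1)).
  move=> t; rewrite in_itv /= => /andP[t0 t1].
  by apply: cmax; rewrite in_itv /= !ltW.
have [_ Dc0] := crit; have [_ DcE] := dphi c (ltW c0) (ltW c1).
have := pcvx _ _ (Sseg c (ltW c0) (ltW c1)) Sxs.
have -> : xs - (y + c *: (xs - y)) = (1 - c) *: (xs - y).
  by rewrite opprD addrA scalerBl scale1r.
rewrite dotvZr -DcE Dc0 mulr0 => /(_ (lexx _)).
by rewrite leNgt -phi1 -[g _]/(phi c) phi1 -gyxs -phi0 (lt_le_trans phis).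
Qed.

End FirstOrder.

(** * Summable sequences and almost-decreasing recursions *)

(** Summability of a nonnegative sequence, in a form that needs no limit. *)
Definition bounded_sums {R : realType} (u : nat -> R) : Prop :=
  exists M, forall N, \sum_(0 <= j < N) u j <= M.

Section BoundedSums.
Context {R : realType}.
Implicit Types (u v V a b c g : nat -> R).

Lemma nneseries_bounded_sums u : (forall k, 0 <= u k) ->
  (\sum_(0 <= k <oo) (u k)%:E < +oo)%E -> bounded_sums u.
Proof.
move=> u0 su; have su_fin : (\sum_(0 <= k <oo) (u k)%:E)%E \is a fin_num.
  by rewrite ge0_fin_numE // nneseries_ge0 // => k _ _; rewrite lee_fin.
exists (fine (\sum_(0 <= k <oo) (u k)%:E)%E) => N.
rewrite -lee_fin fineK // -sumEFin.
by apply: nneseries_lim_ge => k _ _; rewrite lee_fin.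
Qed.

Lemma bounded_sums_nneseries u : (forall k, 0 <= u k) ->
  bounded_sums u -> (\sum_(0 <= k <oo) (u k)%:E < +oo)%E.
Proof.
move=> u0 [M uM]; apply: (@le_lt_trans _ _ M%:E); last exact: ltry.
apply: lime_le; first by apply: is_cvg_nneseries => k _ _; rewrite lee_fin.
by apply: nearW => N; rewrite sumEFin lee_fin.
Qed.

Lemma sum_tail_le u K N : (forall k, 0 <= u k) ->
  \sum_(K <= j < N) u j <= \sum_(0 <= j < N) u j.
Proof.
move=> u0; have [KN|/ltnW NK] := leqP K N.
  by rewrite [leRHS](@big_cat_nat _ _ _ K) //= lerDr sumr_ge0.
by rewrite big_geq // sumr_ge0.
Qed.

Lemma bounded_sums_dominated u v (C : R) K : 0 <= C -> (forall k, 0 <= v k) ->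
  (forall k, (K <= k)%N -> u k <= C * v k) -> bounded_sums v -> bounded_sums u.
Proof.
move=> C0 v0 uv [M vM].
have M0 : 0 <= M by have := vM 0%N; rewrite big_geq.
exists (\sum_(0 <= j < K) `|u j| + C * M) => N.
have norm_ge0 k : 0 <= `|u k| by [].
have [NK|/ltnW KN] := leqP N K.
  rewrite -[leLHS]addr0 lerD ?mulr_ge0 //.
  apply: (@le_trans _ _ (\sum_(0 <= j < N) `|u j|)).
    by apply: ler_sum => j _; exact: ler_norm.
  by rewrite [leRHS](@big_cat_nat _ _ _ N) //= lerDl sumr_ge0.
rewrite (@big_cat_nat _ _ _ K) //= lerD //.
  by apply: ler_sum => j _; exact: ler_norm.
apply: (@le_trans _ _ (C * \sum_(K <= j < N) v j)).
  rewrite mulr_sumr big_nat [leRHS]big_nat.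
  by apply: ler_sum => j /andP[Kj _]; exact: uv.
by rewrite ler_wpM2l // (le_trans (sum_tail_le _ _ v0)).
Qed.

Lemma bounded_sums_shift u K : (forall k, 0 <= u k) ->
  bounded_sums u -> bounded_sums (fun k => u (k + K)%N).
Proof.
move=> u0 [M uM]; exists M => N; apply: le_trans (uM (N + K)%N).
apply: le_trans (sum_tail_le K (N + K) u0).
by rewrite -{2}[K]add0n big_addn addnK.
Qed.

Lemma bounded_sumsD u v :
  bounded_sums u -> bounded_sums v -> bounded_sums (fun k => u k + v k).
Proof.
by move=> [M uM] [M' vM]; exists (M + M') => N; rewrite big_split lerD.
Qed.

Lemma bounded_sums_is_cvg u : (forall k, 0 <= u k) -> bounded_sums u ->
  cvgn (series u).
Proof.
move=> u0 [M uM]; apply: nondecreasing_is_cvgn.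
  by apply: nondecreasing_series => k _ _.
by exists M => _ [N _ <-]; exact: uM.
Qed.

Lemma bounded_sums_cvg0 u : (forall k, 0 <= u k) -> bounded_sums u ->
  u @ \oo --> (0 : R).
Proof. by move=> u0 su; apply/cvg_series_cvg_0/bounded_sums_is_cvg. Qed.

(** Discrete Gronwall estimate: each factor 1 + a k is at most expR (a k). *)
Lemma gronwall_bound V a b : (forall k, 0 <= V k) ->
  (forall k, 0 <= a k) -> (forall k, 0 <= b k) ->
  (forall k, V k.+1 <= (1 + a k) * V k + b k) ->
  forall k, V k <= expR (\sum_(0 <= j < k) a j) * (V 0%N + \sum_(0 <= j < k) b j).
Proof.
move=> V0 a0 b0 Vrec; elim=> [|k IHk].
  by rewrite !big_geq // expR0 mul1r addr0.
rewrite !big_nat_recr //= expRD.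
set E := expR (\sum_(0 <= j < k) a j) in IHk *.
set W := V 0%N + \sum_(0 <= j < k) b j in IHk *.
have W0 : 0 <= W by rewrite addr_ge0 // sumr_ge0.
have E1 : 1 <= E.
  by rewrite (le_trans _ (expR_ge1Dx _)) // lerDl sumr_ge0.
have ea1 : 1 <= expR (a k) by rewrite (le_trans _ (expR_ge1Dx _)) // lerDl.
rewrite addrA -/W mulrDr; apply: (le_trans (Vrec k)); apply: lerD.
  rewrite mulrAC mulrC ler_pM ?addr_ge0 //.
  exact: expR_ge1Dx.
by rewrite ler_peMl // -[1]mulr1 ler_pM.
Qed.

(** Deterministic form of the Robbins-Siegmund lemma.  By the Gronwall estimate
    V is bounded, so the factor 1 + a k only contributes a summable increment;
    V plus the partial sums of c minus those of the increments is then
    nonincreasing.  The recursion is asked from rank K on, because the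
    extragradient estimate holds only for small steps. *)
Lemma robbins_siegmund V a b c K : (forall k, 0 <= V k) ->
  (forall k, 0 <= a k) -> (forall k, 0 <= b k) -> (forall k, 0 <= c k) ->
  bounded_sums a -> bounded_sums b ->
  (forall k, (K <= k)%N -> V k.+1 <= (1 + a k) * V k + b k - c k) ->
  cvgn V /\ bounded_sums c.
Proof.
move=> V0 a0 b0 c0 sa sb Vrec.
wlog K0 : V a b c K V0 a0 b0 c0 sa sb Vrec / K = 0%N => [from0|].
  pose sh (u : nat -> R) k := u (k + K)%N.
  have [] := from0 (sh V) (sh a) (sh b) (sh c) 0%N; rewrite /sh //.
  - exact: bounded_sums_shift.
  - exact: bounded_sums_shift.
  - by move=> k _; rewrite addSn; apply: Vrec; rewrite leq_addl.
  move=> /cvg_ex [l]; rewrite cvg_shiftn => cvV [M cM]; split.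
    by apply/cvg_ex; exists l.
  exists (\sum_(0 <= j < K) c j + M) => N.
  have le_ext : \sum_(0 <= j < N) c j <= \sum_(0 <= j < N + K) c j.
    by rewrite [leRHS](@big_cat_nat _ _ _ N) ?leq_addr //= lerDl sumr_ge0.
  apply: le_trans le_ext _; rewrite (@big_cat_nat _ _ _ K) ?leq_addl //= lerD2l.
  by rewrite -{1}[K]add0n big_addn addnK.
have {K0 K} Vrec k : V k.+1 <= (1 + a k) * V k + b k - c k.
  by apply: Vrec; rewrite K0.
have [A aA] := sa; have [B bB] := sb.
have [M VM] : exists M, forall k, V k <= M.
  exists (expR A * (V 0%N + B)) => k.
  apply: le_trans (gronwall_bound V0 a0 b0 _ k) _.
    by move=> j; apply: le_trans (Vrec j) _; rewrite gerBl.
  by rewrite ler_pM ?expR_ge0 ?addr_ge0 ?sumr_ge0 ?ler_expR ?lerD2l.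
have M0 : 0 <= M by exact: le_trans (V0 0%N) (VM 0%N).
pose e k := a k * M + b k.
have e0 k : 0 <= e k by rewrite /e addr_ge0 ?mulr_ge0.
have [D eD] : bounded_sums e.
  apply: bounded_sumsD => //.
  by apply: (@bounded_sums_dominated _ a M 0%N) => // k _; rewrite mulrC.
have Vstep k : V k.+1 <= V k + e k - c k.
  apply: le_trans (Vrec k) _; rewrite /e mulrDl mul1r.
  have := ler_wpM2l (a0 k) (VM k); lra.
have Vsum k : V k + series c k - series e k <= V 0%N.
  elim: k => [|k IHk]; first by rewrite !seriesEnat /= !big_geq // addr0 subr0.
  rewrite !seriesEnat /= !big_nat_recr //=.
  by move: IHk (Vstep k); rewrite !seriesEnat /=; lra.
have sc : bounded_sums c.
  exists (V 0%N + D) => k.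
  by move: (Vsum k) (eD k) (V0 k); rewrite !seriesEnat /=; lra.
split=> //.
have cvc := bounded_sums_is_cvg c0 sc.
have cve : cvgn (series e) by apply: bounded_sums_is_cvg => //; exists D.
have cvU : cvgn (fun k => V k + series c k - series e k).
  apply: nonincreasing_is_cvgn.
    apply/nonincreasing_seqP => k; rewrite !seriesEnat /= !big_nat_recr //=.
    by have := Vstep k; lra.
  exists (- D) => _ [k _ <-]; have := eD k; have := V0 k.
  have : 0 <= series c k by rewrite seriesEnat sumr_ge0.
  by rewrite !seriesEnat /=; lra.
have -> : V = (fun k => V k + series c k - series e k) - series c + series e.
  by apply/funext => k; rewrite !fctE; lra.
by apply: is_cvgD => //; apply: is_cvgB.
Qed.

(** A lower bound eps on g from rank N on would bound the sums of u by those of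
    u * g divided by eps. *)
Lemma divergent_weights_small g u : (forall k, 0 <= g k) -> (forall k, 0 <= u k) ->
  ~ bounded_sums u -> bounded_sums (fun k => u k * g k) ->
  forall (eps : R) N, 0 < eps -> exists2 k, (N <= k)%N & g k < eps.
Proof.
move=> g0 u0 su sug eps N eps0; apply: contrapT => nsmall; apply: su.
apply: (@bounded_sums_dominated u _ eps^-1 N _ _ _ sug) => [||k Nk].
- by rewrite invr_ge0 ltW.
- by move=> k; rewrite mulr_ge0.
- rewrite mulrC -mulrA ler_peMr // ler_pdivlMr // mul1r leNgt.
  by apply/negP => gk; apply: nsmall; exists k.
Qed.

End BoundedSums.

(** * The extragradient step *)

Section Extragradient.
Context {R : realType} {n : nat}.
Implicit Types (x y s : 'rV[R]_n) (S : set 'rV[R]_n) (F G : 'rV[R]_n -> 'rV[R]_n).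

(** The case p = 0 forces g = 0; otherwise the difference of the two sides times p
    is the square of p * a - g * b. *)
Lemma young_weighted (p q g a b : R) : 0 <= p -> 0 <= q -> p * q = g ^+ 2 ->
  2 * g * a * b <= p * a ^+ 2 + q * b ^+ 2.
Proof.
move=> p0 q0 pq; have [p00|pn0] := eqVneq p 0.
  move: pq; rewrite p00 mul0r => /esym/eqP; rewrite sqrf_eq0 => /eqP ->.
  by rewrite !mulr0 !mul0r add0r mulr_ge0 // sqr_ge0.
have {}p0 : 0 < p by rewrite lt_neqAle eq_sym pn0.
rewrite -(ler_pM2l p0) -subr_ge0.
suff -> : p * (p * a ^+ 2 + q * b ^+ 2) - p * (2 * g * a * b) =
  (p * a - g * b) ^+ 2 by exact: sqr_ge0.
transitivity (p ^+ 2 * a ^+ 2 + (p * q) * b ^+ 2 - 2 * p * g * a * b); first ring.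
by rewrite pq; ring.
Qed.

(** The obtuse-angle inequality at xp is tested against s and the one at xh
    against xp; their sum leaves the defect F x - F xh, which the Lipschitz bound
    and the square of g L |x - xh| - |xp - xh| absorb. *)
Lemma extragradient_step S F (L g : R) x xh xp s :
  closed S -> convex_set S -> S x -> S s -> 0 <= g -> 0 <= L ->
  (forall y z, S y -> S z -> enorm (F y - F z) <= L * enorm (y - z)) ->
  xh = projection S (x - g *: F x) -> xp = projection S (x - g *: F xh) ->
  enorm (xp - s) ^+ 2 <= enorm (x - s) ^+ 2
    - (1 - (g * L) ^+ 2) * enorm (x - xh) ^+ 2 - 2 * g * dotv (F xh) (xh - s).
Proof.
move=> clS cvxS Sx Ss g0 L0 FL xhE xpE.
have S0 : S !=set0 by exists s.
have Sxh : S xh by rewrite xhE; exact: projection_in.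
have Sxp : S xp by rewrite xpE; exact: projection_in.
have obt_p := projection_obtuse (x - g *: F xh) clS cvxS Ss.
have obt_h := projection_obtuse (x - g *: F x) clS cvxS Sxp.
rewrite -xpE in obt_p; rewrite -xhE in obt_h.
have lip : dotv (F x - F xh) (xp - xh) <= L * enorm (x - xh) * enorm (xp - xh).
  apply: le_trans (cauchy_schwarz _ _) _.
  by rewrite ler_wpM2r ?enorm_ge0 // FL.
have {}lip := ler_wpM2l g0 lip.
have sq := sqr_ge0 (g * L * enorm (x - xh) - enorm (xp - xh)).
have -> : (g * L) ^+ 2 = g ^+ 2 * L ^+ 2 by rewrite exprMn.
have young : 2 * (g * dotv (F x - F xh) (xp - xh)) <=
    g ^+ 2 * L ^+ 2 * enorm (x - xh) ^+ 2 + enorm (xp - xh) ^+ 2.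
  move: (dotv _ _) (enorm _) (enorm _) lip sq => c D D' lip sq; lra.
move: young obt_p obt_h; rewrite !sqr_enorm.
move: (F x) (F xh) => fx fh {xhE xpE Sxh Sxp lip sq FL S0}.
rewrite !dotvE (dotvC s x) (dotvC xh x) (dotvC xp xh) (dotvC s xp).
move=> young obt_p obt_h; lra.
Qed.

(** F stands for the gradient at the current parameter and G for the one at the
    limit parameter, at distance e.  The error 2 g Lt e (|x - xh| + |x - s|) is
    split: the first part goes into a quarter of |x - xh| ^+ 2, the second one is
    shared between the weights p and q of the weighted Young inequality. *)
Lemma extragradient_step_perturbed S F G (L Lt g e p q : R) x xh xp s :
  closed S -> convex_set S -> S x -> S s -> 0 <= L -> 0 <= g -> g * L <= 1 / 2 ->
  0 <= Lt -> 0 <= e -> 0 <= p -> 0 <= q -> p * q = g ^+ 2 ->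
  (forall y z, S y -> S z -> enorm (F y - F z) <= L * enorm (y - z)) ->
  (forall y, S y -> enorm (F y - G y) <= Lt * e) ->
  xh = projection S (x - g *: F x) -> xp = projection S (x - g *: F xh) ->
  enorm (xp - s) ^+ 2 <= (1 + Lt ^+ 2 * p) * enorm (x - s) ^+ 2
    + (4 * Lt ^+ 2 * (g ^+ 2 * e ^+ 2) + q * e ^+ 2)
    - (1 / 2 * enorm (x - xh) ^+ 2 + 2 * g * dotv (G xh) (xh - s)).
Proof.
move=> clS cvxS Sx Ss L0 g0 gL Lt0 e0 p0 q0 pq FL FG xhE xpE.
apply: le_trans (extragradient_step clS cvxS Sx Ss g0 L0 FL xhE xpE) _.
have Sxh : S xh by rewrite xhE; apply: projection_in => //; exists s.
have D0 := enorm_ge0 (x - xh); have v0 := enorm_ge0 (x - s).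
have gL0 : 0 <= g * L by rewrite mulr_ge0.
have coef : 3 / 4 * enorm (x - xh) ^+ 2 <=
    (1 - (g * L) ^+ 2) * enorm (x - xh) ^+ 2.
  rewrite ler_wpM2r ?sqr_ge0 // expr2.
  have := ler_pM gL0 gL0 gL gL; lra.
have pert : - dotv (F xh - G xh) (xh - s) <=
    Lt * e * (enorm (x - xh) + enorm (x - s)).
  rewrite -dotvNl; apply: le_trans (cauchy_schwarz _ _) _.
  rewrite enormN ler_pM ?enorm_ge0 // ?FG //.
  rewrite -(enorm_distC xh x) (le_trans _ (ler_enormD _ _)) //.
  by rewrite addrA subrK.
have {}pert := ler_wpM2l g0 pert.
have sq := sqr_ge0 (1 / 2 * enorm (x - xh) - 2 * g * Lt * e).
have young := young_weighted (Lt * enorm (x - s)) e p0 q0 pq.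
move: pert young; rewrite dotvDl dotvNl exprMn => pert young.
move: (dotv (F xh) _) (dotv (G xh) _) pert coef sq young => f1 g1.
lra.
Qed.

End Extragradient.

(** * Pathwise convergence *)

(** Sol abstracts the set of minimizers of the limit problem, with gradient G; F k
    is the gradient at the k-th parameter, whose error is e k.  The squared step
    g k ^+ 2 is split as p k * q k so that p is summable by itself and q is
    summable against the squared errors: in the application p and q are the
    powers of the step with exponents 2 - tau and tau. *)
Section ExtragradientConvergence.
Context {R : realType} {n : nat}.
Variables (S : set 'rV[R]_n) (F : nat -> 'rV[R]_n -> 'rV[R]_n).
Variables (G : 'rV[R]_n -> 'rV[R]_n) (Sol : set 'rV[R]_n).
Variables (L Lt : R) (g e p q : nat -> R) (x xh : nat -> 'rV[R]_n).
Hypotheses (clS : closed S) (cvxS : convex_set S).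
Hypotheses (L_ge0 : 0 <= L) (Lt_ge0 : 0 <= Lt).
Hypothesis F_lip : forall k y z, S y -> S z ->
  enorm (F k y - F k z) <= L * enorm (y - z).
Hypothesis G_lip : forall y z, S y -> S z -> enorm (G y - G z) <= L * enorm (y - z).
Hypothesis FG : forall k y, S y -> enorm (F k y - G y) <= Lt * e k.
Hypotheses (g_ge0 : forall k, 0 <= g k) (e_ge0 : forall k, 0 <= e k).
Hypotheses (p_ge0 : forall k, 0 <= p k) (q_ge0 : forall k, 0 <= q k).
Hypothesis pq : forall k, p k * q k = g k ^+ 2.
Hypotheses (g_cvg0 : g @ \oo --> (0 : R)) (g_div : ~ bounded_sums g).
Hypothesis p_sum : bounded_sums p.
Hypothesis ge_sum : bounded_sums (fun k => g k ^+ 2 * e k ^+ 2).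
Hypothesis qe_sum : bounded_sums (fun k => q k * e k ^+ 2).
Hypothesis SolS : Sol `<=` S.
Hypothesis Sol_monotone : forall s y, Sol s -> S y -> 0 <= dotv (G y) (y - s).
Hypothesis Sol_crit : forall s y, Sol s -> S y -> dotv (G y) (y - s) <= 0 -> Sol y.
Hypothesis x0S : S (x 0%N).
Hypothesis xhE : forall k, xh k = projection S (x k - g k *: F k (x k)).
Hypothesis xE : forall k, x k.+1 = projection S (x k - g k *: F k (xh k)).

Let xS k : S (x k).
Proof.
elim: k => [//|k IHk]; rewrite xE; apply: projection_in => //.
by exists (x k).
Qed.

Let xhS k : S (xh k).
Proof. by rewrite xhE; apply: projection_in => //; exists (x 0%N). Qed.

(** Quasi-Fejer monotonicity with respect to every solution.  The perturbed step
    estimate needs g k * L <= 1 / 2, which holds eventually. *)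
Lemma fejer s : Sol s ->
  cvgn (fun k => enorm (x k - s) ^+ 2) /\
  bounded_sums (fun k => 1 / 2 * enorm (x k - xh k) ^+ 2
                         + 2 * g k * dotv (G (xh k)) (xh k - s)).
Proof.
move=> Sols.
have [K _ gL] : \forall k \near \oo, g k * L <= 1 / 2.
  have half0 : (0 : R) < 1 / 2 by lra.
  have : (fun k => g k * L) @ \oo --> (0 : R).
    by rewrite -(mul0r L); apply: cvgM => //; exact: cvg_cst.
  move=> /(cvgr_lt _) /(_ _ half0); apply: filterS => k; exact: ltW.
pose a k := Lt ^+ 2 * p k.
pose b k := 4 * Lt ^+ 2 * (g k ^+ 2 * e k ^+ 2) + q k * e k ^+ 2.
apply: (@robbins_siegmund _ _ a b _ K) => [k|k|k|k|||k Kk].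
- exact: sqr_ge0.
- by rewrite mulr_ge0 ?sqr_ge0.
- by rewrite addr_ge0 // ?mulr_ge0 ?sqr_ge0.
- by rewrite addr_ge0 // mulr_ge0 ?sqr_ge0 ?Sol_monotone ?mulr_ge0.
- exact: (@bounded_sums_dominated _ _ p (Lt ^+ 2) 0%N (sqr_ge0 _)).
- apply: bounded_sumsD => //.
  apply: (@bounded_sums_dominated _ _ _ (4 * Lt ^+ 2) 0%N _ _ _ ge_sum) => //.
    by rewrite mulr_ge0 ?sqr_ge0.
  by move=> k; rewrite mulr_ge0 ?sqr_ge0.
exact: (extragradient_step_perturbed clS cvxS (xS k) (SolS Sols)
  L_ge0 (g_ge0 k) (gL k Kk) Lt_ge0 (e_ge0 k) (p_ge0 k) (q_ge0 k) (pq k)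
  (@F_lip k) (@FG k) (xhE k) (xE k)).
Qed.

(** The gap inner products have a finite g-weighted sum and g is not summable, so
    they are small along a subsequence kk.  Its iterates stay in a ball around s,
    hence have a cluster point, and the half steps are eventually close. *)
Lemma frequently_near_critical s : Sol s ->
  exists2 y, S y & forall eps N, 0 < eps -> exists k,
    [/\ (N <= k)%N, enorm (x k - y) < eps, enorm (x k - xh k) < eps &
        dotv (G (xh k)) (xh k - s) < eps].
Proof.
move=> Sols; have [cvV sc] := fejer Sols.
pose gap k := dotv (G (xh k)) (xh k - s).
have gap0 k : 0 <= gap k by exact: Sol_monotone.
have c0 k : 0 <= 1 / 2 * enorm (x k - xh k) ^+ 2 + 2 * g k * gap k.
  by rewrite addr_ge0 // mulr_ge0 ?sqr_ge0 ?gap0 ?mulr_ge0.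
have D_cvg0 eps : 0 < eps -> \forall k \near \oo, enorm (x k - xh k) < eps.
  move=> eps0; have eps20 : 0 < 1 / 2 * eps ^+ 2.
    by rewrite mulr_gt0 ?exprn_gt0 //; lra.
  have /(cvgr_lt _) /(_ _ eps20) := bounded_sums_cvg0 c0 sc.
  apply: filterS => k Dk.
  rewrite -ltr_sqr ?nnegrE ?enorm_ge0 ?ltW //.
  have := mulr_ge0 (g_ge0 k) (gap0 k).
  move: Dk; move: (gap k) (enorm _) => u D; lra.
have gap_small eps N : 0 < eps -> exists2 k, (N <= k)%N & gap k < eps.
  apply: (divergent_weights_small gap0 g_ge0 g_div).
  apply: (@bounded_sums_dominated _ _ _ 1 0%N _ _ _ sc) => // k.
  move=> _; rewrite mul1r -/(gap k).
  have := mulr_ge0 (g_ge0 k) (gap0 k); have := sqr_ge0 (enorm (x k - xh k)).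
  move: (gap k) (enorm _) => u D; lra.
have /choice [kk kkP] : forall j : nat, exists k, (j <= k)%N /\ gap k < j.+1%:R^-1.
  move=> j; have [|k jk gk] := gap_small j.+1%:R^-1 j; first by rewrite invr_gt0.
  by exists k.
have [r Vr] : exists r, forall k, enorm (s - x k) <= r.
  have /cvg_seq_bounded [M [_ HM]] := cvV.
  (* M + 1 bounds the squared distances, and t <= t ^+ 2 + 1 *)
  exists (M + 2) => k; have := HM (M + 1) _ k I.
  rewrite ltrDl => /(_ ltr01); rewrite /= ger0_norm ?sqr_ge0 // enorm_distC.
  have := sqr_ge0 (enorm (s - x k) - 1 / 2); move: (enorm _) => D; lra.
pose xk := fun j => x (kk j).
have [|y [[Sy _] cly]] := @compact_enorm_ball _ _ S s r clS _
   (fmap_proper_filter xk eventually_filter) _.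
  by exists 0%N => // j _; split; [exact: xS|exact: Vr].
exists y => // eps N eps0.
have [N1 _ N1P] := D_cvg0 _ eps0.
have [N2 _ N2P] : \forall j \near \oo, (j.+1%:R^-1 : R) < eps.
  exact: near_infty_natSinv_lt (PosNum eps0).
pose N' := maxn N (maxn N1 N2).
have [||_ [[j N'j <-] /= xy]] :=
    cly [set x (kk j) | j in [set j | (N' <= j)%N]] [set z | enorm (y - z) < eps].
- by exists N' => // j /= N'j; exists j.
- exact: near_enorm_lt.
have [jkk gapkk] := kkP j.
have N'kk : (N' <= kk j)%N by exact: leq_trans N'j jkk.
exists (kk j); split.
- by apply: leq_trans N'kk; rewrite leq_maxl.
- by rewrite enorm_distC.
- by apply: N1P; apply: leq_trans N'kk; rewrite /= /N' !leq_max leqnn orbT.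
- apply: lt_trans gapkk _; apply: N2P.
  by apply: leq_trans N'j; rewrite /= /N' !leq_max leqnn !orbT.
Qed.

(** The critical inner product at y exceeds the one at a close xh k by at most a
    constant C times the closeness, by Lipschitz continuity of G. *)
Lemma cluster_critical s y : Sol s -> S y ->
  (forall eps N, 0 < eps -> exists k,
    [/\ (N <= k)%N, enorm (x k - y) < eps, enorm (x k - xh k) < eps &
        dotv (G (xh k)) (xh k - s) < eps]) -> Sol y.
Proof.
move=> Sols Sy near_y; apply: (Sol_crit Sols Sy); rewrite leNgt.
apply/negP => d0; set d := dotv _ _ in d0.
pose C := 2 * (L * enorm (y - s) + enorm (G y) + 2 * L) + 1.
have C1 : 1 <= C.
  by rewrite lerDr mulr_ge0 // !addr_ge0 ?mulr_ge0 ?enorm_ge0.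
have C0 : 0 < C by exact: lt_le_trans C1.
have dC : 0 < d / (2 * C) by rewrite divr_gt0 // mulr_gt0.
have eps0 : 0 < Num.min 1 (d / (2 * C)) by rewrite lt_min ltr01.
have [k [_ xy xxh gap]] := near_y _ 0%N eps0.
set eps := Num.min 1 _ in eps0 xy xxh gap.
have eps1 : eps <= 1 by rewrite ge_min lexx.
have epsd : eps * (2 * C) <= d by rewrite -ler_pdivlMr ?mulr_gt0 // ge_min lexx orbT.
have dist : enorm (y - xh k) <= 2 * eps.
  have -> : y - xh k = (y - x k) + (x k - xh k) by rewrite addrA subrK.
  apply: le_trans (ler_enormD _ _) _.
  by rewrite enorm_distC mulr_natl mulr2n lerD // ltW.
have GG : enorm (G y - G (xh k)) <= L * (2 * eps).
  by apply: le_trans (G_lip Sy (xhS k)) _; rewrite ler_wpM2l.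
have GG1 : enorm (G (xh k)) <= enorm (G y) + L * (2 * eps).
  have -> : G (xh k) = G y - (G y - G (xh k)) by rewrite subKr.
  by apply: le_trans (ler_enormD _ _) _; rewrite enormN lerD2l.
have dE : d = dotv (G y - G (xh k)) (y - s) + dotv (G (xh k)) (y - xh k)
    + dotv (G (xh k)) (xh k - s) by rewrite /d !dotvE; ring.
have t1 : dotv (G y - G (xh k)) (y - s) <= L * (2 * eps) * enorm (y - s).
  by apply: le_trans (cauchy_schwarz _ _) _; rewrite ler_wpM2r ?enorm_ge0.
have t2 : dotv (G (xh k)) (y - xh k) <= (enorm (G y) + L * (2 * eps)) * (2 * eps).
  by apply: le_trans (cauchy_schwarz _ _) _; rewrite ler_pM ?enorm_ge0.
have t3 : L * eps * eps <= L * eps.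
  by rewrite ler_piMr // mulr_ge0 // ltW.
have dle : d <= eps * C.
  rewrite dE /C; move: t1 t2 t3 gap.
  move: (enorm (y - s)) (enorm (G y)) (dotv _ _) (dotv _ _) (dotv _ _).
  clearbody eps; move=> u v d1 d2 d3; lra.
clearbody d eps; rewrite mulrCA in epsd; move: (eps * C) dle epsd => z; lra.
Qed.

(** Opial's argument: y is a solution, so the distances to y converge, and they
    are arbitrarily small along a subsequence. *)
Lemma extragradient_cvg : Sol !=set0 -> exists2 y, Sol y & x @ \oo --> y.
Proof.
move=> [s Sols]; have [y Sy near_y] := frequently_near_critical Sols.
have Soly := cluster_critical Sols Sy near_y.
exists y => //; have [/cvg_ex [l Vl] _] := fejer Soly.
have l0 : l = 0.
  apply/eqP; rewrite eq_le; apply/andP; split; last first.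
    rewrite -(cvg_lim _ Vl) //.
    apply: limr_ge; last by apply: nearW => k; exact: sqr_ge0.
    by apply/cvg_ex; exists l.
  rewrite leNgt; apply/negP => l0.
  have m0 : 0 < Num.min 1 (l / 2) by rewrite lt_min ltr01 divr_gt0.
  have m1 : Num.min 1 (l / 2) <= 1 by rewrite ge_min lexx.
  have ml : Num.min 1 (l / 2) <= l / 2 by rewrite ge_min lexx orbT.
  have l20 : l / 2 < l by lra.
  have [N _ NP] := cvgr_gt _ Vl _ l20.
  have [k [Nk xy _ _]] := near_y _ N m0.
  have := NP k Nk; rewrite /= => lV.
  have : enorm (x k - y) ^+ 2 <= enorm (x k - y).
    rewrite expr2 ler_piMr ?enorm_ge0 //; exact: le_trans (ltW xy) m1.
  by rewrite leNgt (lt_trans xy) // (le_lt_trans ml).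
apply/cvgrPdist_lt => eps eps0.
have eps20 : l < eps ^+ 2 by rewrite l0 exprn_gt0.
have [N _ NP] := cvgr_lt _ Vl _ eps20; exists N => // k Nk.
have := NP k Nk; rewrite /= ltr_sqr ?nnegrE ?enorm_ge0 ?(ltW eps0) // enorm_distC.
by move=> xky; apply: le_lt_trans xky; exact: norm_le_enorm.
Qed.

End ExtragradientConvergence.

(** * Measurability of continuous functions of random vectors *)

Section RandomVectors.
Context {d : measure_display} {T : measurableType d} {R : realType} {n : nat}.
Implicit Types (u : T -> 'rV[R]_n).

(** Only the coordinates of u are known to be measurable; an open set is the
    countable union of the cubes with rational centre and side it contains. *)
Lemma random_vector_preimage_open u A : random_vector u -> open A ->
  measurable (u @^-1` A).
Proof.
move=> ru oA.
pose cube (qk : 'rV[rat]_n * nat) : set 'rV[R]_n :=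
  [set v | forall i, ball (ratr (qk.1 0 i) : R) qk.2.+1%:R^-1 (v 0 i)].
have mcube qk : measurable (u @^-1` cube qk).
  have -> : u @^-1` cube qk = \bigcap_(i in [set: 'I_n])
      ((fun om => u om 0 i) @^-1` ball (ratr (qk.1 0 i) : R) qk.2.+1%:R^-1).
    by apply/seteqP; split => [om h i _|om h i]; [exact: h|exact: h].
  apply: fin_bigcap_measurable => [|i _]; first exact: finite_finset.
  rewrite -[X in measurable X]setTI; apply: ru => //.
  by apply: open_measurable; exact: ball_open.
have -> : u @^-1` A = \bigcup_qk [set om | cube qk `<=` A /\ cube qk (u om)].
  apply/seteqP; split => [om Aom|om [qk _ [cA cu]]]; last exact: cA.
  have /nbhs_ballP [e /= e0 eA] : nbhs (u om) A by apply: oA.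
  have e20 : 0 < e / 2 by rewrite divr_gt0.
  have [k _ /(_ k (leqnn k)) /= ke] := near_infty_natSinv_lt (PosNum e20).
  have k0 : (0 : R) < k.+1%:R^-1 by rewrite invr_gt0.
  have /choice [q qP] : forall i, exists q : rat,
      ball (ratr q : R) k.+1%:R^-1 (u om 0 i).
    move=> i; have [|q] :=
      @rat_in_itvoo R (u om 0 i - k.+1%:R^-1) (u om 0 i + k.+1%:R^-1).
      by rewrite ltrD2l gtrN.
    by rewrite in_itv /= -ltr_distl => qu; exists q; rewrite -ball_normE.
  exists (\row_i q i, k) => //; split; last by move=> i /=; rewrite mxE.
  move=> v /= qv; apply: eA; suff : forall i j, ball (u om i j) e (v i j) by split.
  move=> i j; rewrite (ord1 i).
  have := qv j; have := qP j; rewrite mxE -!ball_normE /= => uq vq.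
  rewrite -[u om 0 j](subrK (ratr (q j))) -addrA (le_lt_trans (ler_normD _ _)) //.
  by rewrite distrC [e]splitr ltrD // (lt_trans _ ke).
apply: countable_bigcupT_measurable => [|qk]; first exact: countableP.
have [cA|ncA] := pselect (cube qk `<=` A).
  rewrite [X in measurable X](_ : _ = u @^-1` cube qk) //.
  by apply/seteqP; split => [om []|om cu].
rewrite [X in measurable X](_ : _ = set0) //.
by apply/seteqP; split => [om []|].
Qed.

Lemma continuous_random_vector u (g : 'rV[R]_n -> R) :
  random_vector u -> continuous g -> measurable_fun [set: T] (fun om => g (u om)).
Proof.
move=> ru cg; apply: (measurability _ (RGenOpens.measurableE R)).
move=> _ [_ [a [b ->] <-]]; rewrite setTI.
rewrite [X in measurable X](_ : _ = u @^-1` (g @^-1` `]a, b[)) //.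
apply: random_vector_preimage_open => //.
by apply: open_comp => [v _|]; [exact: cg|exact: interval_open].
Qed.

End RandomVectors.

(** * Centred noise is orthogonal to the past *)

Import HBSimple HBNNSimple.

Section Orthogonality.
Context {d : measure_display} {T : measurableType d} {R : realType}.
Variables (P : probability T R) (G : set (set T)) (w : T -> R) (A : set T).
Local Notation TG := (g_sigma_algebraType G).
Hypothesis G_sub : <<s G>> `<=` measurable.
Hypothesis w_int : P.-integrable [set: T] (EFin \o w).
Hypothesis w_mean : forall B, <<s G>> B -> (\int[P]_(om in B) (w om)%:E = 0)%E.
Hypothesis GA : <<s G>> A.

Let mA : measurable A. Proof. exact: G_sub. Qed.

Lemma measurable_fun_sub (u : T -> R) :
  measurable_fun [set: TG] u -> measurable_fun [set: T] u.
Proof. by move=> mu _ B mB; apply: G_sub; exact: mu. Qed.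

Lemma sfun_orthogonal (h : {nnsfun TG >-> R}) :
  (\int[P]_(om in A) (h om * w om)%:E = 0)%E.
Proof.
have mh y : <<s G>> (h @^-1` [set y]).
  have mh : measurable_fun [set: TG] h by exact: measurable_funPT.
  by rewrite -[X in <<s G>> X]setTI; apply: mh.
have wA_int : P.-integrable A (EFin \o w).
  exact: integrableS w_int.
have hE om : (h om * w om)%:E = (\sum_(y <- finmap.enum_fset (fset_set (range h)))
    y%:E * ((EFin \o w) \_ (h @^-1` [set y])) om)%E.
  rewrite {1}(fimfunE h) fsbig_finite ?fimfunP //= mulr_suml -sumEFin.
  apply: eq_bigr => y _; rewrite -mulrA EFinM; congr (_ * _)%E.
  rewrite indicE patchE; case: (om \in _); first by rewrite mul1r.
  by rewrite mul0r.
have restr_int y : P.-integrable A ((EFin \o w) \_ (h @^-1` [set y])).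
  apply/(integrable_restrict _ (G_sub (mh y)) mA).
  by apply: integrableS wA_int => //; apply: measurableI => //; exact: G_sub.
under eq_integral do rewrite hE.
rewrite integral_sum => [|//|y]; last exact: integrableZl.
apply: big1 => y _; rewrite integralZl // -integral_mkcondr w_mean ?mule0 //.
exact: (@measurableI _ TG).
Qed.

(** The simple approximations of u lie below u, so u * w dominates. *)
Lemma ge0_orthogonal (u : T -> R) : measurable_fun [set: TG] u ->
  (forall om, 0 <= u om) -> P.-integrable A (EFin \o (u \* w)) ->
  (\int[P]_(om in A) (u om * w om)%:E = 0)%E.
Proof.
move=> mu u0 uw_int.
have mAG : measurable (A : set TG) by [].
have mu' : measurable_fun (A : set TG) (EFin \o u).
  by apply/measurable_EFinP; apply: measurable_funS mu.
pose h m := nnsfun_approx mAG mu' m.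
have EFu0 om : A om -> (0 <= (EFin \o u) om)%E by rewrite lee_fin.
have hu om : A om -> (fun m => h m om) @ \oo --> u om.
  move=> Aom; rewrite /h; under eq_fun do rewrite nnsfun_approxE.
  exact: (cvg_approx EFu0 Aom (ltry _)).
have h_le m om : A om -> h m om <= u om.
  by move=> Aom; rewrite -lee_fin /h nnsfun_approxE; exact: le_approx.
have mh m : measurable_fun [set: T] (h m).
  by apply: measurable_fun_sub; exact: measurable_funP.
have mw : measurable_fun [set: T] w.
  by apply/measurable_EFinP/(measurable_int _ w_int).
have [|||||_ _ ] := @dominated_convergence _ _ _ P A mA
  (fun m om => (h m om * w om)%:E) (EFin \o (u \* w)) (abse \o (EFin \o (u \* w))).
- move=> m; apply/measurable_EFinP.
  exact: measurable_funTS (measurable_funM (mh m) mw).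
- exact: measurable_int uw_int.
- apply: aeW => om Aom; apply: cvg_EFin; first by apply: nearW.
  by apply: cvgM; [exact: hu|exact: cvg_cst].
- exact: integrable_abse.
- apply: aeW => om m Aom; rewrite /= lee_fin !normrM ler_wpM2r //.
  by rewrite !ger0_norm // h_le.
under eq_fun do rewrite sfun_orthogonal.
by move=> /cvg_lim <- //; rewrite lim_cst.
Qed.

(** The pull-out property of conditional expectation, for E[w | G] = 0, from its
    defining integrals: first for simple u, then by dominated convergence for
    u >= 0, and by splitting u into positive and negative parts. *)
Lemma cond_mean0_orthogonal (u : T -> R) : measurable_fun [set: TG] u ->
  P.-integrable A (EFin \o (u \* w)) ->
  (\int[P]_(om in A) (u om * w om)%:E = 0)%E.
Proof.
move=> mu uw_int.
have mw : measurable_fun [set: T] w.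
  by apply/measurable_EFinP/(measurable_int _ w_int).
have part_int (v : T -> R) : measurable_fun [set: TG] v ->
    (forall om, `|v om| <= `|u om|) -> P.-integrable A (EFin \o (v \* w)).
  move=> mv vu; apply: le_integrable uw_int => //.
    apply/measurable_EFinP; apply: measurable_funS (measurable_funM _ mw) => //.
    exact: measurable_fun_sub.
  by move=> om _; rewrite /= lee_fin !normrM ler_wpM2r.
have pos_int : P.-integrable A (EFin \o (u^\+ \* w)).
  apply: part_int; first exact: measurable_funrpos.
  by move=> om; rewrite /funrpos; case: (leP 0 (u om)) => ?; rewrite ?normr0.
have neg_int : P.-integrable A (EFin \o (u^\- \* w)).
  apply: part_int; first exact: measurable_funrneg.
  move=> om; rewrite /funrneg.
  by case: (leP 0 (- u om)) => ?; rewrite ?normr0 ?normrN.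
have uE om : (u om * w om)%:E =
    ((EFin \o (u^\+ \* w)%R) \- (EFin \o (u^\- \* w)%R))%E om.
  rewrite /= -EFinB -mulrBl.
  by rewrite -[u^\+ om - _]/((u^\+ - u^\-) om) funrposBneg.
under eq_integral do rewrite uE.
rewrite integralB // !ge0_orthogonal ?sube0 //.
- exact: measurable_funrneg.
- exact: measurable_funrpos.
Qed.

End Orthogonality.

(** * The projected stochastic gradient step *)

Section ProjectedStep.
Context {R : realType} {p : nat}.
Variables (Theta : set 'rV[R]_p) (H : 'rV[R]_p -> 'rV[R]_p) (mu L : R).
Variable ths : 'rV[R]_p.
Hypotheses (Theta_closed : closed Theta) (Theta_convex : convex_set Theta).
Hypothesis H_mono : forall y z, Theta y -> Theta z ->
  mu * enorm (y - z) ^+ 2 <= dotv (H y - H z) (y - z).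
Hypothesis H_lip : forall y z, Theta y -> Theta z ->
  enorm (H y - H z) <= L * enorm (y - z).
Hypothesis Theta_ths : Theta ths.
Hypothesis ths_crit : forall z, Theta z -> 0 <= dotv (H ths) (z - ths).

(** The noiseless displacement from ths, before projection. *)
Definition drift (b : R) y := (y - ths) - b *: (H y - H ths).

Lemma drift_sqr_le b y : 0 <= L -> 0 <= b -> Theta y ->
  enorm (drift b y) ^+ 2 <=
    (1 + L ^+ 2 * b ^+ 2 - 2 * mu * b) * enorm (y - ths) ^+ 2.
Proof.
move=> L0 b0 Thy; have := ler_wpM2l b0 (H_mono Thy Theta_ths).
have : enorm (H y - H ths) ^+ 2 <= L ^+ 2 * enorm (y - ths) ^+ 2.
  by rewrite -exprMn ler_sqr ?nnegrE ?mulr_ge0 ?enorm_ge0 // H_lip.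
move=> /(ler_wpM2l (sqr_ge0 b)); rewrite /drift !sqr_enorm.
move: (H y - H ths) (y - ths) => u v; rewrite !dotvE (dotvC v u).
lra.
Qed.

(** Stationarity makes ths a fixed point of the noiseless step, so
    nonexpansiveness of the projection applies to the two steps. *)
Lemma projected_step_le b y w : 0 <= b -> Theta y ->
  enorm (projection Theta (y - b *: (H y + w)) - ths) ^+ 2 <=
    enorm (drift b y) ^+ 2 - 2 * b * dotv (drift b y) w + b ^+ 2 * enorm w ^+ 2.
Proof.
move=> b0 Thy.
have fix_ths : projection Theta (ths - b *: H ths) = ths.
  apply: projection_unique => // z Thz.
  rewrite addrAC subrr add0r dotvNl dotvZl oppr_le0 mulr_ge0 //.
  exact: ths_crit.
have -> : enorm (drift b y) ^+ 2 - 2 * b * dotv (drift b y) w + b ^+ 2 * enorm w ^+ 2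
    = enorm (drift b y - b *: w) ^+ 2.
  by move: (drift b y) => v; rewrite !sqr_enorm !dotvE (dotvC w v); ring.
rewrite ler_sqr ?nnegrE ?enorm_ge0 // -{1}fix_ths.
apply: le_trans (projection_nonexpansive _ _ _ _ _) _ => //; first by exists ths.
suff -> : y - b *: (H y + w) - (ths - b *: H ths) = drift b y - b *: w by [].
by rewrite /drift; apply/rowP => i; rewrite !mxE; ring.
Qed.

(** A bound without cross term, for proving integrability. *)
Lemma projected_step_le2 b y w : 0 <= b -> Theta y ->
  enorm (projection Theta (y - b *: (H y + w)) - ths) ^+ 2 <=
    2 * enorm (drift b y) ^+ 2 + 2 * b ^+ 2 * enorm w ^+ 2.
Proof.
move=> b0 Thy; apply: le_trans (projected_step_le w b0 Thy) _.
have := dotvv_ge0 (drift b y + b *: w).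
by move: (drift b y) => v; rewrite !sqr_enorm !dotvE (dotvC w v); lra.
Qed.

(** H is Lipschitz on Theta only; composing it with the projection gives a map
    that is continuous on the whole space and agrees with it on Theta. *)
Lemma projection_gradient_continuous i : 0 <= L ->
  continuous (fun y => H (projection Theta y) 0 i).
Proof.
move=> L0; have Theta0 : Theta !=set0 by exists ths.
apply: (@enorm_lipschitz_continuous _ _ _ L) => // y z.
have := coord_le_enorm (H (projection Theta y) - H (projection Theta z)) i.
rewrite !mxE => /le_trans; apply; apply: (le_trans (H_lip _ _)).
- exact: projection_in.
- exact: projection_in.
- by rewrite ler_wpM2l // projection_nonexpansive.
Qed.

Lemma projection_coord_continuous i : continuous (fun y => projection Theta y 0 i).
Proof.
have Theta0 : Theta !=set0 by exists ths.
apply: (@enorm_lipschitz_continuous _ _ _ 1) => // y z.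
have := coord_le_enorm (projection Theta y - projection Theta z) i.
rewrite !mxE mul1r => /le_trans; apply.
exact: projection_nonexpansive.
Qed.

Lemma gradient_coord_measurable d (T : measurableType d) (u : T -> 'rV[R]_p) i :
  0 <= L -> (forall om, Theta (u om)) -> random_vector u ->
  measurable_fun [set: T] (fun om => H (u om) 0 i).
Proof.
move=> L0 uTheta ru.
have -> : (fun om => H (u om) 0 i) = (fun om => H (projection Theta (u om)) 0 i).
  by apply/funext => om; rewrite projection_id.
exact: (@continuous_random_vector _ _ _ _ _
  (fun y => H (projection Theta y) 0 i) ru (@projection_gradient_continuous i L0)).
Qed.

End ProjectedStep.

(** * Almost sure summability of the parameter errors *)

Section StochasticApproximation.
Context {R : realType} {p : nat}.
Context {d : measure_display} {T : measurableType d} (P : probability T R).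
Variables (Theta : set 'rV[R]_p) (H : 'rV[R]_p -> 'rV[R]_p) (mu L nu2 : R).
Variables (ths : 'rV[R]_p) (bet : nat -> R) (th w : nat -> T -> 'rV[R]_p).
Hypotheses (Theta_closed : closed Theta) (Theta_convex : convex_set Theta).
Hypotheses (mu_gt0 : 0 < mu) (L_ge0 : 0 <= L) (nu2_ge0 : 0 <= nu2).
Hypothesis H_mono : forall y z, Theta y -> Theta z ->
  mu * enorm (y - z) ^+ 2 <= dotv (H y - H z) (y - z).
Hypothesis H_lip : forall y z, Theta y -> Theta z ->
  enorm (H y - H z) <= L * enorm (y - z).
Hypothesis Theta_ths : Theta ths.
Hypothesis ths_crit : forall z, Theta z -> 0 <= dotv (H ths) (z - ths).
Hypothesis bet_ge0 : forall k, 0 <= bet k.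
Hypothesis bet_sqr_sum : bounded_sums (fun k => bet k ^+ 2).
Hypothesis th0_random : random_vector (th 0%N).
Hypothesis w_random : forall k, random_vector (w k).
Hypothesis th0_Theta : forall om, Theta (th 0%N om).
Hypothesis th_def : forall k om, th k.+1 om =
  projection Theta (th k om - bet k *: (H (th k om) + w k om)).

(** Generators of the part of the history needed to test the noise w k: th k
    determines the drift, and th 0 the event on which expectations are taken. *)
Definition present k : set (set T) :=
  coord_preimages (th 0%N) `|` coord_preimages (th k).

Hypothesis w_int : forall k i,
  P.-integrable [set: T] (EFin \o (fun om => w k om 0 i)).
Hypothesis w_mean : forall k i B, <<s present k>> B ->
  (\int[P]_(om in B) (w k om 0 i)%:E = 0)%E.
Hypothesis w_sqr_int : forall k,
  P.-integrable [set: T] (EFin \o (fun om => enorm (w k om) ^+ 2)).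
Hypothesis w_sqr_mean : forall k,
  \int[P]_om (enorm (w k om) ^+ 2) <= nu2.

Let err k om := enorm (th k om - ths) ^+ 2.

Let thTheta k om : Theta (th k om).
Proof.
by case: k => [//|k]; rewrite th_def; apply: projection_in => //; exists ths.
Qed.

Lemma th_random k : random_vector (th k).
Proof.
elim: k => [//|k IHk] i.
pose z om := th k om - bet k *: (H (th k om) + w k om).
have z_random : random_vector z.
  move=> j; rewrite /z.
  under eq_fun do rewrite !mxE.
  apply: measurable_funB; first exact: IHk.
  apply: measurable_funM; first exact: measurable_cst.
  apply: measurable_funD; last exact: w_random.
  exact: (gradient_coord_measurable Theta_closed Theta_convex H_lip Theta_ths j
    L_ge0 (thTheta k) IHk).
have -> : (fun om => th k.+1 om 0 i) = (fun om => projection Theta (z om) 0 i).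
  by apply/funext => om; rewrite th_def.
apply: (@continuous_random_vector _ _ _ _ _
  (fun y => projection Theta y 0 i) z_random).
exact: projection_coord_continuous Theta_ths _.
Qed.

Lemma present_measurable k : <<s present k>> `<=` measurable.
Proof.
apply: smallest_sub; first exact: sigma_algebra_measurable.
move=> B [[i _ [Y mY <-]]|[i _ [Y mY <-]]]; exact: th_random.
Qed.

Local Notation TG k := (g_sigma_algebraType (present k)).

Lemma th_present k : random_vector (th k : TG k -> 'rV[R]_p).
Proof.
move=> i _ Y mY; apply: sub_gen_smallest; right.
by exists i => //; exists Y.
Qed.

Lemma th0_present k : random_vector (th 0%N : TG k -> 'rV[R]_p).
Proof.
move=> i _ Y mY; apply: sub_gen_smallest; left.
by exists i => //; exists Y.
Qed.

Lemma dist_ths_continuous : continuous (fun y : 'rV[R]_p => enorm (y - ths)).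
Proof.
have -> : (fun y : 'rV[R]_p => enorm (y - ths)) = (fun y => enorm (ths - y)).
  by apply/funext => y; rewrite enorm_distC.
exact: dist_enorm_continuous.
Qed.

Section Localization.
Variable M : R.

(** The initial point need not be square integrable: all expectations are taken on
    an event, known from the start, where it is bounded. *)
Let A := [set om | enorm (th 0%N om - ths) <= M].

Lemma localization_present k : <<s present k>> A.
Proof.
have := continuous_random_vector (@th0_present k) dist_ths_continuous measurableT.
move=> /(_ `]-oo, M]%classic (measurable_itv _)); rewrite setTI.
by congr (<<s _>> _); apply/seteqP; split => om; rewrite /= in_itv.
Qed.

Let mA : measurable A.
Proof. exact: (@present_measurable 0%N _ (@localization_present 0%N)). Qed.

Lemma err_measurable k : measurable_fun [set: T] (err k).
Proof.
apply: measurable_funX.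
exact: continuous_random_vector (@th_random k) dist_ths_continuous.
Qed.

Let v k om := drift H ths (bet k) (th k om).

Lemma drift_coord_measurable k i : measurable_fun [set: TG k]
  (fun om => v k om 0 i).
Proof.
rewrite /v /drift; under eq_fun do rewrite !mxE.
apply: measurable_funB.
  by apply: measurable_funB; [exact: th_present|exact: measurable_cst].
apply: measurable_funM; first exact: measurable_cst.
apply: measurable_funB; last exact: measurable_cst.
exact: (gradient_coord_measurable (T := TG k) Theta_closed Theta_convex H_lip
  Theta_ths i L_ge0 (thTheta k) (@th_present k)).
Qed.

Lemma dominated_integrable (f g : T -> R) : measurable_fun [set: T] f ->
  (forall om, A om -> `|f om| <= g om) -> P.-integrable A (EFin \o g) ->
  P.-integrable A (EFin \o f).
Proof.
move=> mf fg gint; apply: le_integrable gint => //.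
  by apply/measurable_EFinP; exact: measurable_funTS.
move=> om Aom; rewrite /= lee_fin (le_trans (fg _ Aom)) //.
exact: ler_norm.
Qed.

Let w_sqr_intA k : P.-integrable A (EFin \o (fun om => enorm (w k om) ^+ 2)).
Proof. exact: integrableS (w_sqr_int k). Qed.

Lemma integrable_lin (f g : T -> R) (a b : R) :
  P.-integrable A (EFin \o f) -> P.-integrable A (EFin \o g) ->
  P.-integrable A (EFin \o (fun om => a * f om + b * g om)).
Proof.
move=> fint gint.
have -> : EFin \o (fun om => a * f om + b * g om) =
    (fun om => a%:E * (EFin \o f) om)%E \+ (fun om => b%:E * (EFin \o g) om)%E.
  by [].
by apply: integrableD => //; exact: integrableZl.
Qed.

Let cst_int (c : R) : P.-integrable A (EFin \o cst c).
Proof. exact: finite_measure_integrable_cst. Qed.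

Let drift_le k om : enorm (v k om) ^+ 2 <=
  (1 + L ^+ 2 * bet k ^+ 2) * err k om.
Proof.
apply: le_trans
  (drift_sqr_le H_mono H_lip Theta_ths L_ge0 (bet_ge0 k) (thTheta k om)) _.
rewrite ler_wpM2r ?sqr_ge0 // gerBl mulr_ge0 ?mulr_ge0 //.
exact: ltW.
Qed.

Lemma err_integrable k : P.-integrable A (EFin \o err k).
Proof.
elim: k => [|k IHk].
  apply: (dominated_integrable (err_measurable 0%N) _ (cst_int (M ^+ 2))).
  move=> om Aom; rewrite ger0_norm ?sqr_ge0 // ler_sqr ?nnegrE ?enorm_ge0 //.
  exact: le_trans (enorm_ge0 _) Aom.
have := integrable_lin (2 * (1 + L ^+ 2 * bet k ^+ 2)) (2 * bet k ^+ 2)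
  IHk (w_sqr_intA k).
apply: dominated_integrable; first exact: err_measurable.
move=> om Aom; rewrite ger0_norm ?sqr_ge0 // /err th_def.
apply: le_trans (projected_step_le2 _ _ _ _ _ _ _) _ => //.
by rewrite lerD2r -mulrA ler_wpM2l // drift_le.
Qed.

Let noise k om := dotv (v k om) (w k om).

Lemma noise_coord_integrable k i : P.-integrable A
  (EFin \o ((fun om => v k om 0 i) \* (fun om => w k om 0 i))).
Proof.
have := integrable_lin (1 + L ^+ 2 * bet k ^+ 2) 1 (err_integrable k) (w_sqr_intA k).
apply: dominated_integrable.
  apply: measurable_funM; last exact: w_random.
  apply: (measurable_fun_sub (@present_measurable k)).
  exact: drift_coord_measurable.
move=> om _ /=; rewrite mul1r normrM.
have le1 := coord_le_enorm (v k om) i.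
have le2 := coord_le_enorm (w k om) i.
apply: le_trans (ler_pM (normr_ge0 _) (normr_ge0 _) le1 le2) _.
apply: (@le_trans _ _ (enorm (v k om) ^+ 2 + enorm (w k om) ^+ 2));
  last by rewrite lerD2r drift_le.
move: (enorm _) (enorm _) (enorm_ge0 (v k om)) (enorm_ge0 (w k om)).
move=> a b a0 b0; have := sqr_ge0 (a - b); have := mulr_ge0 a0 b0; lra.
Qed.

Lemma noise_mean0 k : (\int[P]_(om in A) (noise k om)%:E = 0)%E.
Proof.
under eq_integral do rewrite /noise /dotv -sumEFin.
rewrite integral_sum // => [|i]; last exact: noise_coord_integrable.
apply: big1 => i _.
have := cond_mean0_orthogonal (@present_measurable k) (w_int k i) (@w_mean k i)
  (@localization_present k) (@drift_coord_measurable k i)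
  (@noise_coord_integrable k i).
exact.
Qed.

Lemma noise_integrable k : P.-integrable A (EFin \o noise k).
Proof.
have -> : EFin \o noise k = (fun om => (\sum_(i < p) (EFin \o
    ((fun om => v k om 0 i) \* (fun om => w k om 0 i))%R) om)%E).
  by apply/funext => om; rewrite /= /noise /dotv sumEFin.
by apply: integrable_sum => // i _; exact: noise_coord_integrable.
Qed.

Lemma Rintegral_lin (f g : T -> R) (a b : R) :
  P.-integrable A (EFin \o f) -> P.-integrable A (EFin \o g) ->
  \int[P]_(om in A) (a * f om + b * g om) =
  a * \int[P]_(om in A) f om + b * \int[P]_(om in A) g om.
Proof.
move=> fint gint; rewrite RintegralD //.
- by rewrite !RintegralZl.
- exact: (integrableZl mA a fint).
- exact: (integrableZl mA b gint).
Qed.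

Let V k := \int[P]_(om in A) err k om.

Lemma mean_err_recursion k :
  V k.+1 <= (1 + L ^+ 2 * bet k ^+ 2) * V k + nu2 * bet k ^+ 2
    - 2 * mu * (bet k * V k).
Proof.
pose a := 1 + L ^+ 2 * bet k ^+ 2 - 2 * mu * bet k.
have main_int := integrable_lin a (bet k ^+ 2) (err_integrable k) (w_sqr_intA k).
have rhs_int := integrable_lin 1 (- (2 * bet k)) main_int (noise_integrable k).
have le_step : V k.+1 <= \int[P]_(om in A)
    (1 * (a * err k om + bet k ^+ 2 * enorm (w k om) ^+ 2)
      + - (2 * bet k) * noise k om).
  apply: le_Rintegral => // [|om Aom]; first exact: err_integrable.
  rewrite /err th_def.
  apply: le_trans (projected_step_le Theta_closed Theta_convex Theta_ths ths_crit
    (w k om) (bet_ge0 k) (thTheta k om)) _.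
  have drift_le_a :=
    drift_sqr_le H_mono H_lip Theta_ths L_ge0 (bet_ge0 k) (thTheta k om).
  apply: le_trans (lerD (lerD drift_le_a (lexx _)) (lexx _)) _.
  by rewrite mul1r mulNr addrAC.
apply: le_trans le_step _.
rewrite (Rintegral_lin _ _ main_int (noise_integrable k)).
rewrite (Rintegral_lin _ _ (err_integrable k) (w_sqr_intA k)).
rewrite -/(V k) {2}/Rintegral noise_mean0 /= mulr0 addr0 mul1r.
have W_le : \int[P]_(om in A) enorm (w k om) ^+ 2 <= nu2.
  apply: le_trans (w_sqr_mean k); apply: fine_le.
  - by apply: integrable_fin_num => //; exact: w_sqr_intA.
  - by apply: integrable_fin_num => //; exact: w_sqr_int.
  - apply: ge0_subset_integral => //.
      exact: measurable_int (w_sqr_int k).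
    by move=> om _; rewrite lee_fin sqr_ge0.
have := ler_wpM2l (sqr_ge0 (bet k)) W_le; rewrite /a.
move: (V k) (Rintegral _ _ _) => m I; lra.
Qed.

(** The sum of the expectations is controlled by the deterministic recursion, in
    which 2 * mu * bet k * V k plays the role of the decrease. *)
Lemma weighted_err_integral_summable :
  (\sum_(0 <= k <oo) \int[P]_(om in A) (bet k * err k om)%:E < +oo)%E.
Proof.
have V0 k : 0 <= V k by apply: Rintegral_ge0 => om _; exact: sqr_ge0.
have VE k : (\int[P]_(om in A) (bet k * err k om)%:E)%E = (bet k * V k)%:E.
  under eq_integral do rewrite EFinM.
  rewrite integralZl //; last exact: err_integrable.
  rewrite EFinM fineK //; apply: integrable_fin_num => //.
  exact: err_integrable.
under eq_eseriesr do rewrite VE.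
have mu20 : 0 < 2 * mu by rewrite mulr_gt0.
apply: bounded_sums_nneseries => [k|]; first by rewrite mulr_ge0.
have [] := @robbins_siegmund _ V (fun k => L ^+ 2 * bet k ^+ 2)
  (fun k => nu2 * bet k ^+ 2) (fun k => 2 * mu * (bet k * V k)) 0%N V0.
- by move=> k; rewrite mulr_ge0 ?sqr_ge0.
- by move=> k; rewrite mulr_ge0 ?sqr_ge0.
- by move=> k; rewrite !mulr_ge0 // ltW.
- exact: (@bounded_sums_dominated _ _ _ (L ^+ 2) 0%N (sqr_ge0 _)
    (fun k => sqr_ge0 _) (fun k _ => lexx _) bet_sqr_sum).
- exact: (@bounded_sums_dominated _ _ _ nu2 0%N nu2_ge0
    (fun k => sqr_ge0 _) (fun k _ => lexx _) bet_sqr_sum).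
- by move=> k _; exact: mean_err_recursion.
move=> _; apply: (@bounded_sums_dominated _ _ _ (2 * mu)^-1 0%N) => [|k|k _].
- by rewrite invr_ge0 ltW.
- by rewrite !mulr_ge0 // ltW.
- by rewrite mulKf // gt_eqF.
Qed.

Lemma weighted_err_summable_on :
  {ae P, forall om, A om -> bounded_sums (fun k => bet k * err k om)}.
Proof.
have mterm k : measurable_fun A (fun om => (bet k * err k om)%:E).
  apply/measurable_EFinP; apply: measurable_funTS.
  by apply: measurable_funM; [exact: measurable_cst|exact: err_measurable].
have term0 k om : A om -> (0 <= (bet k * err k om)%:E)%E.
  by move=> _; rewrite lee_fin mulr_ge0 // sqr_ge0.
have sum_int : P.-integrable A
    (fun om => (\sum_(0 <= k <oo) (bet k * err k om)%:E)%E).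
  apply/integrableP; split.
    apply: (@ge0_emeasurable_sum _ _ _ _ (fun k om => (bet k * err k om)%:E) xpredT)
      => [k om Aom _|k _ _ Y mY]; [exact: term0|exact: mterm].
  rewrite (eq_integral (fun om => (\sum_(0 <= k <oo) (bet k * err k om)%:E)%E)).
    rewrite (integral_nneseries _ mA mterm term0).
    exact: weighted_err_integral_summable.
  move=> om; rewrite inE => Aom; rewrite gee0_abs //.
  by apply: nneseries_ge0 => k _ _; exact: term0.
apply: filterS (integrable_ae mA sum_int) => om fin Aom.
apply: nneseries_bounded_sums => [k|]; first by rewrite mulr_ge0 // sqr_ge0.
have := fin Aom; rewrite ge0_fin_numE // nneseries_ge0 // => k _ _; exact: term0.
Qed.

End Localization.

(** The localization events with integer radius exhaust the space. *)
Theorem weighted_err_summable :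
  {ae P, forall om, bounded_sums (fun k => bet k * enorm (th k om - ths) ^+ 2)}.
Proof.
apply: filterS (ae_foralln (fun M : nat => weighted_err_summable_on M%:R))
  => om sumM.
apply: (sumM (Num.truncn (enorm (th 0%N om - ths))).+1) => /=.
exact/ltW/truncnS_gt.
Qed.

End StochasticApproximation.

(** * Convergence of the joint scheme *)

(** Monotonicity of the integral for almost everywhere inequalities is used between
    nonnegative functions, hence the detour through the positive part. *)
Lemma ae_le_Rintegral_cst d (T : measurableType d) (R : realType)
    (P : probability T R) (V : T -> R) (c : R) : 0 <= c ->
  P.-integrable [set: T] (EFin \o V) -> {ae P, forall om, V om <= c} ->
  \int[P]_om V om <= c.
Proof.
move=> c0 Vint Vc.
have Vp_int : P.-integrable [set: T] (EFin \o V^\+) by exact: integrable_funrpos.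
apply: (@le_trans _ _ (\int[P]_om V^\+ om)).
  by apply: le_Rintegral => // om _; rewrite /funrpos le_max lexx.
rewrite -lee_fin fineK; last exact: integrable_fin_num.
apply: (@le_trans _ _ (\int[P]_om (cst c%:E om))%E).
  apply: ae_ge0_le_integral => //.
  - by move=> om _; rewrite lee_fin /funrpos le_max lexx orbT.
  - exact: measurable_int Vp_int.
  - apply: filterS Vc => om Vom _; rewrite lee_fin /funrpos ge_max Vom //.
by rewrite integral_cst // [X in (_ * X)%E]probability_setT mule1.
Qed.

Theorem proposition3p5 (R : realType) (n p : nat)
  (d : measure_display) (T : measurableType d) (P : probability T R)
  (X : set 'rV[R]_n) (Theta : set 'rV[R]_p)
  (f : 'rV[R]_n -> 'rV[R]_p -> R) (h : 'rV[R]_p -> R)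
  (muh Lf Lth Lh B nu tau : R) (ths : 'rV[R]_p)
  (gam bet : nat -> R)
  (x xhalf : nat -> T -> 'rV[R]_n) (th w : nat -> T -> 'rV[R]_p)
  (X_nonempty : X !=set0) (X_closed : closed X) (X_convex : convex_set X)
  (Theta_nonempty : Theta !=set0) (Theta_closed : closed Theta)
  (Theta_convex : convex_set Theta)
  (f_diff : forall x1 th1, X x1 -> Theta th1 -> differentiable (f^~ th1) x1)
  (h_diff : forall th1, Theta th1 -> differentiable h th1)
  (* gradient specifications *)
  (f_pseudoconvex : forall th1 x1 x2, Theta th1 -> X x1 -> X x2 ->
    0 <= dotv (gradient (f^~ th1) x1) (x2 - x1) -> f x1 th1 <= f x2 th1)
  (muh_gt0 : 0 < muh)
  (h_strongly_convex : forall th1 th2, Theta th1 -> Theta th2 ->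
    muh * enorm (th1 - th2) ^+ 2 <=
    dotv (gradient h th1 - gradient h th2) (th1 - th2))
  (Lf_gt0 : 0 < Lf) (Lth_gt0 : 0 < Lth) (Lh_gt0 : 0 < Lh)
  (f_lipschitz_x : forall x1 x2 th1, X x1 -> X x2 -> Theta th1 ->
    enorm (gradient (f^~ th1) x1 - gradient (f^~ th1) x2) <=
    Lf * enorm (x1 - x2))
  (f_lipschitz_th : forall x1 th1 th2, X x1 -> Theta th1 -> Theta th2 ->
    enorm (gradient (f^~ th1) x1 - gradient (f^~ th2) x1) <=
    Lth * enorm (th1 - th2))
  (h_lipschitz : forall th1 th2, Theta th1 -> Theta th2 ->
    enorm (gradient h th1 - gradient h th2) <= Lh * enorm (th1 - th2))
  (B_gt0 : 0 < B)
  (f_grad_bounded : forall x1, X x1 -> enorm (gradient (f^~ ths) x1) <= B)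
  (* step sizes *)
  (gam_gt0 : forall k, 0 < gam k) (bet_gt0 : forall k, 0 < bet k)
  (gam_sum : (\sum_(0 <= k <oo) (gam k)%:E = +oo)%E)
  (gam_sqr_sum : (\sum_(0 <= k <oo) (gam k ^+ 2)%:E < +oo)%E)
  (bet_sum : (\sum_(0 <= k <oo) (bet k)%:E = +oo)%E)
  (bet_sqr_sum : (\sum_(0 <= k <oo) (bet k ^+ 2)%:E < +oo)%E)
  (bet_le : forall k, bet k <= bet 0%N)
  (bet0_le : bet 0%N <= 2 * muh / Lh ^+ 2)
  (tau_gt0 : 0 < tau) (tau_lt1 : tau < 1)
  (gam_tau_sum : (\sum_(0 <= k <oo) (gam k `^ (2 - tau))%:E < +oo)%E)
  (gam_bet : (fun k => gam k `^ tau / bet k) @ \oo --> (0 : R))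
  (* solvability *)
  (ths_argmin : is_minimizer Theta h ths)
  (f_min_attained : exists xm, is_minimizer X (f^~ ths) xm)
  (* joint scheme *)
  (x0_random : random_vector (x 0%N)) (x0_X : forall om, X (x 0%N om))
  (th0_random : random_vector (th 0%N)) (th0_Theta : forall om, Theta (th 0%N om))
  (w_random : forall k, random_vector (w k))
  (xhalf_def : forall k om, xhalf k om =
    projection X (x k om - gam k *: gradient (f^~ (th k om)) (x k om)))
  (x_def : forall k om, x k.+1 om =
    projection X (x k om - gam k *: gradient (f^~ (th k om)) (xhalf k om)))
  (th_def : forall k om, th k.+1 om =
    projection Theta (th k om - bet k *: (gradient h (th k om) + w k om)))
  (* noise *)
  (nu_gt0 : 0 < nu)
  (w_mean : forall k (i : 'I_p),
    is_cond_exp P (history x th k) (fun om => w k om 0 i) (fun=> 0))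
  (w_sqr_mean : forall k, exists V : T -> R,
    is_cond_exp P (history x th k) (fun om => enorm (w k om) ^+ 2) V /\
    {ae P, forall om, V om <= nu ^+ 2}) :
  {ae P, forall om, exists xs : 'rV[R]_n,
    [/\ X xs,
        (fun k => x k.+1 om) @ \oo --> xs &
        forall y, X y -> 0 <= dotv (gradient (f^~ ths) xs) (y - xs)]}.
Proof.
have [ths_Theta ths_min] := ths_argmin.
have ths_crit z : Theta z -> 0 <= dotv (gradient h ths) (z - ths).
  by move=> Thz; apply: minimizer_first_order Thz => //; exact: h_diff.
have present_history k : <<s present th k>> `<=` history x th k.
  apply: sub_sigma_algebra2 => C [Cth|Cth].
    by exists 0%N => //; right.
  by exists k => //=; right.
have w_int k i : P.-integrable [set: T] (EFin \o (fun om => w k om 0 i)).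
  by case: (w_mean k i).
have w_mean0 k i C : <<s present th k>> C ->
    (\int[P]_(om in C) (w k om 0 i)%:E = 0)%E.
  move=> /present_history hC; have [_ _ _ /(_ C hC) <-] := w_mean k i.
  exact: integral0.
have w_sqr_int k : P.-integrable [set: T] (EFin \o (fun om => enorm (w k om) ^+ 2)).
  by have [V [[]]] := w_sqr_mean k.
have w_sqr_le k : \int[P]_om (enorm (w k om) ^+ 2) <= nu ^+ 2.
  have [V [[_ Vint _ VE] Vnu]] := w_sqr_mean k.
  rewrite /Rintegral -VE; last exact: (@measurableT _ (g_sigma_algebraType _)).
  by apply: ae_le_Rintegral_cst => //; exact: sqr_ge0.
have bet_sq : bounded_sums (fun k => bet k ^+ 2).
  by apply: nneseries_bounded_sums => // k; exact: sqr_ge0.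
have := weighted_err_summable Theta_closed Theta_convex muh_gt0 (ltW Lh_gt0)
  (sqr_ge0 nu) h_strongly_convex h_lipschitz ths_Theta ths_crit
  (fun k => ltW (bet_gt0 k)) bet_sq th0_random w_random th0_Theta th_def
  w_int w_mean0 w_sqr_int w_sqr_le.
apply: filterS => om bet_err_sum.
have gam_sq : bounded_sums (fun k => gam k ^+ 2).
  by apply: nneseries_bounded_sums => // k; exact: sqr_ge0.
have gam_cvg0 : gam @ \oo --> (0 : R).
  apply/cvgrPdist_lt => eps eps0.
  have eps20 : 0 < eps ^+ 2 by rewrite exprn_gt0.
  have := bounded_sums_cvg0 (fun k => sqr_ge0 (gam k)) gam_sq.
  move=> /(cvgr_lt _) /(_ _ eps20) [N _ NP]; exists N => // k Nk.
  have := NP k Nk; rewrite /= ltr_sqr ?nnegrE ?ltW // sub0r normrN gtr0_norm //.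
have gam_div : ~ bounded_sums gam.
  move=> /(bounded_sums_nneseries (fun k => ltW (gam_gt0 k))).
  by rewrite gam_sum ltxx.
pose p' k := gam k `^ (2 - tau); pose q k := gam k `^ tau.
have pp0 k : 0 <= p' k by exact: powR_ge0.
have q0 k : 0 <= q k by exact: powR_ge0.
have pq k : p' k * q k = gam k ^+ 2.
  by rewrite -powRD ?subrK ?powR_mulrn ?ltW // gt_eqF ?implybT.
have p_sum : bounded_sums p' by exact: nneseries_bounded_sums.
pose e k := enorm (th k om - ths).
(* the ratio of gam k `^ tau to bet k is eventually below 1 *)
have qe_sum : bounded_sums (fun k => q k * e k ^+ 2).
  have [N _ NP] := cvgr_lt _ gam_bet _ ltr01.
  apply: (@bounded_sums_dominated _ _ _ 1 N _ _ _ bet_err_sum) => // [k|k Nk].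
    by rewrite mulr_ge0 ?sqr_ge0 ?ltW.
  rewrite mul1r ler_wpM2r ?sqr_ge0 //.
  by have := NP k Nk; rewrite /= ltr_pdivrMr // mul1r => /ltW.
(* gam k ^+ 2 = p' k * q k is eventually below q k, since p' tends to 0 *)
have ge_sum : bounded_sums (fun k => gam k ^+ 2 * e k ^+ 2).
  have [N _ NP] := cvgr_lt _ (bounded_sums_cvg0 pp0 p_sum) _ ltr01.
  apply: (@bounded_sums_dominated _ _ _ 1 N _ _ _ qe_sum) => // [k|k Nk].
    by rewrite mulr_ge0 ?sqr_ge0.
  rewrite mul1r -pq ler_wpM2r ?sqr_ge0 // ler_piMl //.
  exact/ltW/(NP k Nk).
have thTheta k : Theta (th k om).
  by case: k => [//|k]; rewrite th_def; apply: projection_in => //; exists ths.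
have min_crit s y : is_minimizer X (f^~ ths) s -> X y ->
    dotv (gradient (f^~ ths) y) (y - s) <= 0 -> is_minimizer X (f^~ ths) y.
  move=> [Xs smin] Xy ys; split=> // z Xz; apply: le_trans (smin z Xz).
  by apply: f_pseudoconvex => //; rewrite -opprB dotvNr oppr_ge0.
have [y [Xy ymin] xy] := @extragradient_cvg _ _ X
  (fun k => gradient (f^~ (th k om))) (gradient (f^~ ths))
  [set s | is_minimizer X (f^~ ths) s] Lf Lth gam e p' q (x^~ om) (xhalf^~ om)
  X_closed X_convex (ltW Lf_gt0) (ltW Lth_gt0)
  (fun k y z Xy Xz => f_lipschitz_x y z (th k om) Xy Xz (thTheta k))
  (fun y z Xy Xz => f_lipschitz_x y z ths Xy Xz ths_Theta)
  (fun k y Xy => f_lipschitz_th y _ _ Xy (thTheta k) ths_Theta)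
  (fun k => ltW (gam_gt0 k)) (fun k => enorm_ge0 _) pp0 q0 pq gam_cvg0 gam_div
  p_sum ge_sum qe_sum (fun s smin => smin.1)
  (fun s y smin Xy => pseudoconvex_minimizer_monotone X_convex
     (fun z Xz => f_diff z ths Xz ths_Theta)
     (fun x1 x2 => f_pseudoconvex ths x1 x2 ths_Theta) smin Xy)
  min_crit (x0_X om) (xhalf_def^~ om) (x_def^~ om) f_min_attained.
exists y; split=> // [|z Xz].
  by rewrite -cvg_shiftS in xy.
by apply: (minimizer_first_order X_convex) Xz => //; exact: f_diff.
Qed.
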